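(* Let $1/2<\alpha<1$ and $\gamma>0$. The identity map on $\mathcal{P}^{\cos}$ extends uniquely to an isomorphism (bounded linear bijection with bounded inverse) between the half-period cosine space $H_{\alpha,\gamma,1}^{\cos}$ and the fractional Sobolev-type space $H_{\alpha,\gamma,1}^{\mathrm{sob}}$. Thus, after this canonical identification, the two spaces coincide as sets, and their norms are equivalent with constants independent of $\gamma$ and $f$; that is, there are constants $0<c\le C<\infty$, independent of $\gamma$ and $f$, such that $c\,\|f\|_{\alpha,\gamma,1}^{\cos}\le \|f\|_{\alpha,\gamma,1}^{\mathrm{sob}}\le C\,\|f\|_{\alpha,\gamma,1}^{\cos}$ for all $f$ in this common space.
   Context: All functions are real-valued on $[0,1]$. Let $\phi_0(x)=1$ and $\phi_k(x)=\sqrt{2}\cos(k\pi x)$ for $k\in\mathbb{N}=\{1,2,\ldots\}$; $\{\phi_k\}_{k\ge 0}$ is an orthonormal basis of $L_2([0,1])$. For $f\in L_2([0,1])$ put $\widetilde f(k)=\int_0^1 f(x)\phi_k(x)\,dx$. Half-period cosine space: for $\alpha>1/2$, $\gamma>0$, $H_{\alpha,\gamma,1}^{\cos}$ is the Hilbert space of all $f\in L_2([0,1])$ with finite norm given by $$(\|f\|_{\alpha,\gamma,1}^{\cos})^2=|\widetilde f(0)|^2+\frac{1}{\gamma^2}\sum_{k=1}^\infty k^{2\alpha}|\widetilde f(k)|^2 .$$ Let $\mathcal{P}^{\cos}=\operatorname{span}\{\phi_k\mid k\in\mathbb{N}_0\}$ (finite linear combinations). For $1/2<\alpha<1$ and $f,g\in\mathcal{P}^{\cos}$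 define $$\mathcal{B}_\alpha(f,g)=\frac{(1-\alpha)\pi^3}{8}\int_0^1\!\int_0^1\left(\frac{(f(x)-f(y))(g(x)-g(y))}{\left|\sin\left(\frac{\pi(x-y)}{2}\right)\right|^{2\alpha+1}}+\frac{(f(x)-f(y))(g(x)-g(y))}{\left|\sin\left(\frac{\pi(x+y)}{2}\right)\right|^{2\alpha+1}}\right)dx\,dy,$$ $$\langle f,g\rangle_{\alpha,\gamma,1}^{\mathrm{sob}}=\int_0^1 f(x)\,dx\int_0^1 g(x)\,dx+\frac{1}{\gamma^2}\mathcal{B}_\alpha(f,g).$$ $H_{\alpha,\gamma,1}^{\mathrm{sob}}$ is the completion of $\mathcal{P}^{\cos}$ with respect to the norm $\|\cdot\|_{\alpha,\gamma,1}^{\mathrm{sob}}$ induced by this inner product. *)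

(* Defs.v *)
From HB Require Import structures.
From mathcomp Require Import all_boot all_order all_algebra.
From mathcomp Require Import all_classical all_reals all_analysis.
From mathcomp Require Import measurable_realfun ring.
Set Implicit Arguments.
Unset Strict Implicit.
Unset Printing Implicit Defensive.
Import Order.TTheory GRing.Theory Num.Theory.
Import numFieldNormedType.Exports.
Local Open Scope classical_set_scope.
Local Open Scope ring_scope.
Local Open Scope quotient_scope.

(* The vector space of a.e.-classes of p-integrable functions, as a quotient of
   [LfunType].  The library's [LspaceType] is not used: it has no algebraic
   structure, and its functions and those of [LfunType] live in measurable
   types with different displays. *)
Section Lp.
Context d (T : measurableType d) (R : realType).
Variables (mu : {measure set T -> \bar R}) (p : \bar R) (p1 : (1 <= p)%E).

Notation Lf := (LfunType mu p1).

Definition ae_eqb (f g : Lf) : bool := `[< \forall x \ae mu, f x = g x >].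

Let ae_eqb_refl : reflexive ae_eqb.
Proof. by move=> f; apply/asboolP; exact: nearW. Qed.

Let ae_eqb_sym : symmetric ae_eqb.
Proof.
by move=> f g; apply/idP/idP => /asboolP h; apply/asboolP; apply: filterS h.
Qed.

Let ae_eqb_trans : transitive ae_eqb.
Proof.
move=> f g h /asboolP gf /asboolP fh; apply/asboolP.
by apply: filterS2 gf fh => x -> ->.
Qed.

Canonical ae_eqb_equiv := EquivRel ae_eqb ae_eqb_refl ae_eqb_sym ae_eqb_trans.

Definition Lp : Type := {eq_quot ae_eqb}.
HB.instance Definition _ := Choice.on Lp.
HB.instance Definition _ := EqQuotient.on Lp.

Lemma LpP (f g : Lf) :
  \pi_Lp f = \pi_Lp g <-> \forall x \ae mu, f x = g x.
Proof.
split=> [/eqP|fg]; first by rewrite eqmodE => /asboolP.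
by apply/eqP; rewrite eqmodE; exact/asboolP.
Qed.

Lemma Lp_repr_ae (f : Lf) : \forall x \ae mu, (repr (\pi_Lp f) : Lf) x = f x.
Proof. by apply/LpP; rewrite reprK. Qed.

Definition Lp_zero : Lp := \pi_Lp 0.
Definition Lp_opp (f : Lp) : Lp := \pi_Lp (- repr f).
Definition Lp_add (f g : Lp) : Lp := \pi_Lp (repr f + repr g).
Definition Lp_scale (a : R) (f : Lp) : Lp := \pi_Lp (a *: repr f).

Lemma Lp_oppE (f : Lf) : Lp_opp (\pi_Lp f) = \pi_Lp (- f).
Proof.
apply/LpP; apply: filterS (Lp_repr_ae f) => x e.
by change (- (repr (\pi_Lp f) : Lf) x = - f x); rewrite e.
Qed.

Lemma Lp_addE (f g : Lf) : Lp_add (\pi_Lp f) (\pi_Lp g) = \pi_Lp (f + g).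
Proof.
apply/LpP; apply: filterS2 (Lp_repr_ae f) (Lp_repr_ae g) => x ef eg.
change ((repr (\pi_Lp f) : Lf) x + (repr (\pi_Lp g) : Lf) x = f x + g x).
by rewrite ef eg.
Qed.

Lemma Lp_scaleE a (f : Lf) : Lp_scale a (\pi_Lp f) = \pi_Lp (a *: f).
Proof.
apply/LpP; apply: filterS (Lp_repr_ae f) => x e.
by change (a * (repr (\pi_Lp f) : Lf) x = a * f x); rewrite e.
Qed.

Let Lp_ind (P : Lp -> Prop) : (forall f : Lf, P (\pi_Lp f)) -> forall f, P f.
Proof. by move=> Pf f; rewrite -[f]reprK; exact: Pf. Qed.

Let Lp_addA : associative Lp_add.
Proof.
apply: Lp_ind => f; apply: Lp_ind => g; apply: Lp_ind => h.
by rewrite (Lp_addE g h) (Lp_addE f g) (Lp_addE f) (Lp_addE _ h) addrA.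
Qed.

Let Lp_addC : commutative Lp_add.
Proof.
by apply: Lp_ind => f; apply: Lp_ind => g; rewrite (Lp_addE f) (Lp_addE g) addrC.
Qed.

Let Lp_add0 : left_id Lp_zero Lp_add.
Proof. by apply: Lp_ind => f; rewrite (Lp_addE 0) add0r. Qed.

Let Lp_addN : left_inverse Lp_zero Lp_opp Lp_add.
Proof. by apply: Lp_ind => f; rewrite (Lp_oppE f) (Lp_addE _ f) addNr. Qed.

HB.instance Definition _ :=
  GRing.isZmodule.Build Lp Lp_addA Lp_addC Lp_add0 Lp_addN.

Let Lp_scaleA a b (f : Lp) : Lp_scale a (Lp_scale b f) = Lp_scale (a * b) f.
Proof.
elim/Lp_ind: f => f.
by rewrite (Lp_scaleE b f) (Lp_scaleE a) (Lp_scaleE _ f) scalerA.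
Qed.

Let Lp_scale1 : left_id 1 Lp_scale.
Proof. by apply: Lp_ind => f; rewrite (Lp_scaleE 1 f) scale1r. Qed.

Let Lp_scaleDr : right_distributive Lp_scale +%R.
Proof.
move=> a; apply: Lp_ind => f; apply: Lp_ind => g.
rewrite [_ + _](Lp_addE f g) (Lp_scaleE a) (Lp_scaleE a f) (Lp_scaleE a g).
by rewrite [RHS](Lp_addE (a *: f) (a *: g)) scalerDr.
Qed.

Let Lp_scaleDl (f : Lp) : {morph Lp_scale^~ f : a b / a + b}.
Proof.
move=> a b; elim/Lp_ind: f => f.
rewrite (Lp_scaleE a f) (Lp_scaleE b f) (Lp_scaleE (a + b) f).
by rewrite [RHS](Lp_addE (a *: f) (b *: f)) scalerDl.
Qed.

HB.instance Definition _ := GRing.Zmodule_isLmodule.Build R Lp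
  Lp_scaleA Lp_scale1 Lp_scaleDr Lp_scaleDl.

Definition Lp_fun (f : Lp) : T -> R := (repr f : Lf).

Lemma Lp_funD (f g : Lp) : \forall x \ae mu, Lp_fun (f + g) x = Lp_fun f x + Lp_fun g x.
Proof. exact: Lp_repr_ae. Qed.

Lemma Lp_funZ a (f : Lp) : \forall x \ae mu, Lp_fun (a *: f) x = a * Lp_fun f x.
Proof. exact: Lp_repr_ae. Qed.

Lemma Lp_fun0 : \forall x \ae mu, Lp_fun 0 x = 0.
Proof. exact: Lp_repr_ae. Qed.

Lemma Lp_fun_ae_inj (f g : Lp) : (\forall x \ae mu, Lp_fun f x = Lp_fun g x) -> f = g.
Proof. by move/LpP; rewrite !reprK. Qed.

Lemma Lp_fun_Lfun (f : Lp) : Lp_fun f \in Lfun mu p.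
Proof. exact: LfunP. Qed.

End Lp.
Coercion Lp_fun : Lp >-> Funclass.

Lemma lee1_2 (R : realType) : (1 <= 2%:E :> \bar R)%E.
Proof. by rewrite lee_fin ler1n. Qed.

Definition mu01 (R : realType) : {measure set (measurableTypeR R) -> \bar R} :=
  mrestr (@lebesgue_measure R) (measurable_itv `[(0 : R), 1]).

(* L_2([0,1]).  Representatives are functions on the whole line, but [mu01] is
   carried by [0,1], so that their values outside [0,1] are irrelevant. *)
Notation L2 R := (Lp (mu01 R) (lee1_2 R)).

Definition phi (R : realType) (k : nat) (x : R) : R :=
  if k == 0%N then 1 else Num.sqrt 2 * cos (k%:R * pi * x).

Definition cos_coef (R : realType) (f : L2 R) (k : nat) : R :=
  \int[mu01 R]_x (f x * phi k x).

Section Hcos.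
Variables (R : realType) (alpha gamma : R).

Definition cos_sqnorm (f : L2 R) : \bar R :=
  ((cos_coef f 0 ^+ 2)%:E +
   (gamma ^- 2)%:E *
     \sum_(1 <= k <oo) (k%:R `^ (2 * alpha) * cos_coef f k ^+ 2)%:E)%E.

Definition finite_cos_norm : {pred L2 R} := fun f => (cos_sqnorm f < +oo)%E.

Lemma continuous_phi k : continuous (@phi R k).
Proof.
rewrite /phi; case: eqP => _ x; first exact: cvg_cst.
apply: cvgM; first exact: cvg_cst.
apply: continuous_comp; last exact: continuous_cos.
by apply: cvgM; [exact: cvg_cst | exact: cvg_id].
Qed.

Lemma measurable_phi k : measurable_fun [set: measurableTypeR R] (@phi R k).
Proof. exact: continuous_measurable_fun (@continuous_phi k). Qed.

Lemma phi_bound k (x : R) : `|phi k x| <= 2.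
Proof.
rewrite /phi; case: eqP => _; first by rewrite normr1 ler1n.
rewrite normrM ger0_norm ?sqrtr_ge0// -[leRHS]mulr1.
apply: ler_pM => //; rewrite ?sqrtr_ge0 ?cos_max//.
by rewrite -[leRHS]ger0_norm// -sqrtr_sqr ler_sqrt// -natrX ler_nat.
Qed.

Lemma mu01_fin_num : mu01 R [set: measurableTypeR R] \is a fin_num.
Proof.
by rewrite /mu01/= /mrestr setTI lebesgue_measure_itv/= lte_fin ltr01 -EFinB.
Qed.

Lemma integrable_cos_coef (f : L2 R) k :
  (mu01 R).-integrable [set: measurableTypeR R] (EFin \o (fun x => f x * phi k x)).
Proof.
have /Lfun_subset12 : (f : _ -> R) \in Lfun (mu01 R) 2%:E by exact: Lp_fun_Lfun.
move=> /(_ mu01_fin_num)/Lfun1_integrable fint.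
have /andP[/[!inE]/= mf _] := Lp_fun_Lfun f.
apply: (le_integrable _ _ _ (integrableZl _ 2 fint)) => //.
  apply/measurable_EFinP; apply: measurable_funM => //.
  exact: measurable_phi.
move=> x _; rewrite /= lee_fin !normrM mulrC ler_wpM2r//.
by rewrite [leRHS]ger0_norm//; exact: phi_bound.
Qed.

Lemma cos_coefP a (f g : L2 R) k :
  cos_coef (a *: f + g) k = a * cos_coef f k + cos_coef g k.
Proof.
rewrite /cos_coef -RintegralZl//; last exact: integrable_cos_coef.
rewrite -RintegralD//; last 2 first.
- exact: (integrableZl _ a (integrable_cos_coef f k)).
- exact: integrable_cos_coef.
rewrite /Rintegral; congr fine; apply: ae_eq_integral => //.
- exact: measurable_int (integrable_cos_coef _ k).
- have := integrableD measurableT (integrableZl measurableT a (integrable_cos_coef f k))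
    (integrable_cos_coef g k).
  exact: measurable_int.
- apply: filterS2 (Lp_funD (a *: f) g) (Lp_funZ a f) => x -> -> _.
  by rewrite mulrDl mulrA.
Qed.

Lemma cos_coef0 k : cos_coef (0 : L2 R) k = 0.
Proof.
have e := cos_coefP (-1) 0 (0 : L2 R) k.
by rewrite mulN1r addNr scaler0 addr0 in e.
Qed.

Lemma finite_cos_norm_submod_closed : submod_closed finite_cos_norm.
Proof.
have w0 (h : L2 R) k : (0 <= (k%:R `^ (2 * alpha) * cos_coef h k ^+ 2)%:E)%E.
  by rewrite lee_fin mulr_ge0 ?powR_ge0 ?sqr_ge0.
have g0 : (0 <= (gamma ^- 2)%:E)%E by rewrite lee_fin invr_ge0 sqr_ge0.
have sq (a x y : R) : (a * x + y) ^+ 2 <= 2 * a ^+ 2 * x ^+ 2 + 2 * y ^+ 2.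
  rewrite -subr_ge0 [X in 0 <= X](_ : _ = (a * x - y) ^+ 2) ?sqr_ge0//; ring.
split=> [|a f g]; rewrite !unfold_in /cos_sqnorm.
  rewrite cos_coef0 eseries0 ?mule0 ?expr0n ?adde0 ?ltry// => k _ _.
  by rewrite cos_coef0 expr0n mulr0.
move=> ff fg.
have a0 : (0 <= (2 * a ^+ 2)%:E)%E by rewrite lee_fin mulr_ge0// sqr_ge0.
apply: (@le_lt_trans _ _
  ((2 * a ^+ 2)%:E * cos_sqnorm f + 2%:E * cos_sqnorm g)%E); last first.
  apply: lte_add_pinfty; exact: lte_mul_pinfty.
rewrite /cos_sqnorm !ge0_muleDr ?lee_fin ?sqr_ge0 ?mule_ge0 ?nneseries_ge0//.
rewrite addeACA leeD//; first by rewrite -!EFinM -EFinD lee_fin cos_coefP sq.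
rewrite ![((2 * _)%:E * (_ * _))%E]muleCA ![(2%:E * (_ * _))%E]muleCA.
rewrite -ge0_muleDr ?(mule_ge0 a0) ?mule_ge0 ?nneseries_ge0//.
rewrite lee_wpmul2l// -!nneseriesZl// -nneseriesD; last 2 first.
- by move=> k _ _; rewrite mule_ge0.
- by move=> k _ _; rewrite mule_ge0.
apply: lee_nneseries => [k _ _|k _]; first exact: w0.
rewrite -!EFinM -EFinD lee_fin cos_coefP.
apply: (le_trans (ler_wpM2l (powR_ge0 _ _) (sq _ _ _))).
by rewrite le_eqVlt; apply/orP; left; apply/eqP; ring.
Qed.

HB.instance Definition _ := GRing.isSubmodClosed.Build _ _ finite_cos_norm
  finite_cos_norm_submod_closed.

Record Hcos := MkHcos {
  Hcos_L2 :> L2 R;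
  Hcos_finite : Hcos_L2 \in finite_cos_norm
}.
HB.instance Definition _ := [isSub for Hcos_L2].
HB.instance Definition _ := [Choice of Hcos by <:].
HB.instance Definition _ := [SubChoice_isSubLmodule of Hcos by <:].

Definition Hcos_norm (f : Hcos) : R := Num.sqrt (fine (cos_sqnorm f)).

End Hcos.

Section Pcos.
Variable R : realType.

Definition cos_span : {pred R -> R} := fun f =>
  `[< exists n (a : nat -> R), forall x, f x = \sum_(k < n) a k * phi k x >].

Lemma cos_span_submod_closed : submod_closed cos_span.
Proof.
split=> [|a f g].
  by apply/asboolP; exists 0%N, (fun=> 0) => x; rewrite big_ord0.
move=> /asboolP[n [u fu]] /asboolP[m [v gv]]; apply/asboolP.
exists (n + m)%N, (fun k => a * (u k *+ (k < n)%N) + v k *+ (k < m)%N) => x.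
have trunc (w : nat -> R) j l : (j <= l)%N ->
    \sum_(k < l) (w k *+ (k < j)%N) * phi k x = \sum_(k < j) w k * phi k x.
  move=> jl; rewrite (big_ord_widen _ (fun k => w k * phi k x) jl) [RHS]big_mkcond.
  by apply: eq_bigr => k _; case: ifP => _; rewrite ?mulr1n ?mulr0n ?mul0r.
have -> : (a *: f + g) x = a * f x + g x by [].
rewrite fu gv -(trunc u n (n + m)%N) ?leq_addr// -(trunc v m (n + m)%N) ?leq_addl//.
rewrite mulr_sumr -big_split; apply: eq_bigr => k _ /=.
by rewrite mulrDl mulrA.
Qed.

HB.instance Definition _ := GRing.isSubmodClosed.Build _ _ cos_span
  cos_span_submod_closed.

(* A cosine polynomial is determined by its restriction to [0,1]. *)
Record Pcos := MkPcos {
  Pcos_fun :> R -> R;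
  Pcos_span : Pcos_fun \in cos_span
}.
HB.instance Definition _ := [isSub for Pcos_fun].
HB.instance Definition _ := [Choice of Pcos by <:].
HB.instance Definition _ := [SubChoice_isSubLmodule of Pcos by <:].

(* On the null set where a denominator vanishes, the quotient is 0 by the
   convention x / 0 = 0. *)
Definition sob_form (alpha : R) (f g : Pcos) : R :=
  (1 - alpha) * pi ^+ 3 / 8 *
  \int[mu01 R]_y \int[mu01 R]_x
    ((f x - f y) * (g x - g y) /
       `|sin (pi * (x - y) / 2)| `^ (2 * alpha + 1) +
     (f x - f y) * (g x - g y) /
       `|sin (pi * (x + y) / 2)| `^ (2 * alpha + 1)).

Definition sob_inner (alpha gamma : R) (f g : Pcos) : R :=
  (\int[mu01 R]_x f x) * (\int[mu01 R]_x g x) + gamma ^- 2 * sob_form alpha f g.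

Definition sob_norm (alpha gamma : R) (f : Pcos) : R :=
  Num.sqrt (sob_inner alpha gamma f f).

End Pcos.

Definition is_completion (R : realType) (E : lmodType R) (N : E -> R)
    (V : completeNormedModType R) (i : {linear E -> V}) : Prop :=
  (forall x, `|i x| = N x) /\ dense (range i).

Definition bounded_op (R : realType) (E F : Type) (N : E -> R) (N' : F -> R)
    (T : E -> F) : Prop :=
  exists M : R, forall x, N' (T x) <= M * N x.

Definition isomorphism (R : realType) (E F : lmodType R)
    (N : E -> R) (N' : F -> R) (T : {linear E -> F}) : Prop :=
  exists S : {linear F -> E},
    [/\ cancel T S, cancel S T, bounded_op N N' T & bounded_op N' N S].

(* Every cosine polynomial belongs to the cosine space, and [T] sends it to
   its image in the completion; its a.e.-class [f] is unique. *)
Definition extends_id (R : realType) (alpha gamma : R) (V : lmodType R)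
    (i : {linear Pcos R -> V}) (T : {linear Hcos alpha gamma -> V}) : Prop :=
  forall p : Pcos R, exists2 f : Hcos alpha gamma,
    (\forall x \ae mu01 R, f x = p x) & T f = i p.

(* Main.v *)
(* The form [B_alpha] is diagonal in the cosine basis: since cosine polynomials
   and the kernel are even and 2-periodic, the double integral becomes an
   integral over [h] in [0,1] of the increments [f (y + h) - f y] and
   [f (y - h) - f y], whose squared norms are explicit by orthogonality.  The
   eigenvalues are comparable to [k^(2 alpha)]: split the integral at [h = 1/k]
   for the upper bound, and restrict it to [1/(2k), 1/k] for the lower bound.
   Hence both norms are weighted l2 norms of the cosine coefficients with
   comparable weights, and the cosine space with the diagonalised Sobolev norm
   is a completion of the cosine polynomials.  This uses that coefficients
   determine a function (polynomials in [cos (pi x)] approximate indicators of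
   initial intervals) and that every sequence with finite weighted norm occurs
   (it is summable because [alpha > 1/2]).  Any other completion is isometric
   to this one. *)
Require Import Defs.
From HB Require Import structures.
From mathcomp Require Import all_boot all_order all_algebra.
From mathcomp Require Import all_classical all_reals all_analysis.
From mathcomp Require Import measurable_realfun ring lra.
Import Order.TTheory GRing.Theory Num.Theory.
Import numFieldNormedType.Exports.
Local Open Scope classical_set_scope.
Local Open Scope ring_scope.

Set Implicit Arguments.
Unset Strict Implicit.
Unset Printing Implicit Defensive.

(** * Lebesgue integrals of shifted and periodic functions *)

(** Uniformity in [gamma] comes from the shape of the weights: both are 1 at frequency 0 and carry
    the same factor [gamma ^- 2] at every other frequency, so only the ratio of an eigenvalue to
    [k^(2 alpha)] enters the constants. The condition [alpha < 1] acts near [h = 0]: there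
    [1 - cos (k pi h)] is of order [(k h)^2] and the kernel of order [h^(- 2 alpha - 1)], which
    leaves the integrable power [h^(1 - 2 alpha)]. The form is defined by iterated real integrals,
    which read a non-finite value as 0, so rearranging them directly would require integrability of
    a singular kernel beforehand. The diagonalisation is therefore computed with extended
    nonnegative integrals, where Tonelli is unconditional, and finiteness of the eigenvalues allows
    the return to real integrals at the end. The model completion has the very elements of the
    cosine space, so in it the extension of the identity is the identity; for any other completion
    this map is composed with the isometry between the two. *)

Section translation.
Context {R : realType}.
Local Notation mu := (@lebesgue_measure R).
Local Open Scope ereal_scope.
Implicit Types (G : R -> \bar R) (a b c : R).

Lemma ge0_integral_itv_split G a b c : (a <= b)%R -> (b <= c)%R ->
  measurable_fun [set: measurableTypeR R] G -> (forall x, 0 <= G x) ->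
  \int[mu]_(x in `[a, c]) G x =
    \int[mu]_(x in `[a, b]) G x + \int[mu]_(x in `[b, c]) G x.
Proof.
move=> ab bc mG G0.
rewrite (@itv_bndbnd_setU _ _ (BLeft a) (BLeft b) (BRight c)) ?bnd_simp//.
rewrite ge0_integral_setU//=; last 2 first.
- exact: measurable_funS mG.
- apply/disj_setPS => x [/=]; rewrite !in_itv/= => /andP[_ xb] /andP[bx _].
  by move: (lt_le_trans xb bx); rewrite ltxx.
by congr (_ + _); rewrite integral_itv_bndo_bndc//; exact: measurable_funS mG.
Qed.

(** The image of Lebesgue measure under the shift gives every half-open interval its length, hence
    is Lebesgue measure by uniqueness. *)
Lemma ge0_integral_shift G a b c :
  measurable_fun [set: measurableTypeR R] G -> (forall x, 0 <= G x) ->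
  \int[mu]_(x in `[a, b]) G (x + c)%R = \int[mu]_(x in `[(a + c)%R, (b + c)%R]) G x.
Proof.
move=> mG G0.
pose s : R -> measurableTypeR R := fun x => (x + c)%R.
have ms : measurable_fun [set: measurableTypeR R] s by exact: measurable_funD.
have preim (l r : bool) u v : s @^-1` [set` Interval (BSide l (u + c)%R) (BSide r (v + c)%R)] =
    [set` Interval (BSide l u) (BSide r v)].
  apply/seteqP; split => x /=; rewrite !in_itv/= /s.
    by case: l; case: r => /=; rewrite ?lerD2r ?ltrD2r.
  by case: l; case: r => /=; rewrite ?lerD2r ?ltrD2r.
rewrite -(preim true false a b).
transitivity (\int[pushforward mu s]_(x in `[(a + c)%R, (b + c)%R]) G x).
  by rewrite ge0_integral_pushforward//; exact: measurable_funS mG.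
apply: eq_measure_integral => A mA _; apply/esym.
apply: lebesgue_measure_unique => // _ [[u v]] _ <-.
rewrite /= /pushforward.
rewrite -[in RHS](subrK c u) -[in RHS](subrK c v) preim.
rewrite !lebesgue_measure_itv/= !lte_fin ltrD2r; case: ifP => // _.
by rewrite -!EFinB; congr EFin; lra.
Qed.

Lemma ge0_integral_opp G a b :
  measurable_fun [set: measurableTypeR R] G -> (forall x, 0 <= G x) ->
  \int[mu]_(x in `[a, b]) G (- x)%R = \int[mu]_(x in `[(- b)%R, (- a)%R]) G x.
Proof.
move=> mG G0.
have -> : `[a, b]%classic = (-%R : _ -> measurableTypeR R) @^-1` `[(- b)%R, (- a)%R].
  by apply/seteqP; split => x /=; rewrite !in_itv/= !lerN2 andbC.
rewrite -(@ge0_integral_pushforward _ _ _ _ _ (-%R : measurableTypeR R -> measurableTypeR R) _ mu)//.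
- by apply: eq_measure_integral => A mA _; exact/lebesgue_measureN.
- exact: measurable_funS mG.
Qed.

(* Both sides are integrals of [G] over one period, centred at [0] and at [y]. *)
Lemma ge0_integral_periodic G (y : R) : (0 <= y <= 1)%R ->
  measurable_fun [set: measurableTypeR R] G -> (forall x, 0 <= G x) ->
  (forall x, G (x + 2)%R = G x) ->
  \int[mu]_(x in `[0%R, 1%R]) G x + \int[mu]_(x in `[0%R, 1%R]) G (- x)%R =
  \int[mu]_(x in `[0%R, 1%R]) G (y + x)%R +
  \int[mu]_(x in `[0%R, 1%R]) G (y - x)%R.
Proof.
move=> /andP[y0 y1] mG G0 per.
have mGN : measurable_fun [set: measurableTypeR R] (fun x => G (- x)%R).
  exact: measurableT_comp.
rewrite (ge0_integral_opp 0 1 mG G0) oppr0.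
transitivity (\int[mu]_(x in `[(-1)%R, 1%R]) G x).
  by rewrite addeC -ge0_integral_itv_split//; lra.
transitivity (\int[mu]_(x in `[(y - 1)%R, (y + 1)%R]) G x).
  rewrite (@ge0_integral_itv_split _ _ (y - 1)%R)//; [|lra..].
  rewrite addeC [RHS](@ge0_integral_itv_split _ _ 1)//; [|lra..].
  congr (_ + _).
  (* Moving the centre of the window from 0 to [y] trades [[-1, y - 1]] for [[1, y + 1]], its
     translate by one period. *)
  have -> : \int[mu]_(x in `[(-1)%R, (y - 1)%R]) G x =
      \int[mu]_(x in `[(-1)%R, (y - 1)%R]) G (x + 2)%R.
    by apply: eq_integral => x _; rewrite per.
  rewrite ge0_integral_shift//.
  have -> : (-1 + 2 = 1 :> R)%R by lra.
  by have -> : (y - 1 + 2 = y + 1 :> R)%R by lra.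
rewrite (@ge0_integral_itv_split _ _ y)//; [|lra..].
rewrite addeC; congr (_ + _).
  under [RHS]eq_integral do rewrite addrC.
  by rewrite ge0_integral_shift// add0r addrC.
transitivity (\int[mu]_(x in `[(-1)%R, 0%R]) G (x + y)%R).
  by rewrite ge0_integral_shift// add0r addrC.
have := @ge0_integral_opp (fun x => G (x + y)%R) 0 1; rewrite oppr0 => <-//.
  by apply: eq_integral => x _; rewrite addrC.
by apply: measurableT_comp => //; exact: measurable_funD.
Qed.

End translation.

Section unit_interval.
Context {R : realType}.
Local Notation mu := (@lebesgue_measure R).
Local Notation T := (measurableTypeR R).

Lemma mu01_setC : mu01 R (~` `[0, 1]) = 0%E.
Proof. by rewrite /mu01 /= /mrestr setICl measure0. Qed.

Lemma integral_mu01 (f : T -> \bar R) : measurable_fun [set: T] f ->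
  (\int[mu01 R]_x f x = \int[mu]_(x in `[0%R, 1%R]) f x)%E.
Proof.
move=> mf.
transitivity (\int[mu01 R]_(x in `[0%R, 1%R]) f x)%E; last first.
  apply: eq_measure_integral => A mA A01.
  by rewrite /mu01 /= /mrestr setIidl.
rewrite [RHS]integral_mkcond; apply: ae_eq_integral => //.
  by apply/measurable_restrict => //; exact: measurable_funS mf.
exists (~` `[0, 1]); split => //; [exact: measurableC|exact: mu01_setC|].
apply: subsetC => x /= x01 _; rewrite patchE ifT//.
by rewrite inE.
Qed.

Lemma ge0_integral_mu01_periodic (G : R -> \bar R) (y : R) : 0 <= y <= 1 ->
  measurable_fun [set: T] G -> (forall x, 0 <= G x)%E ->
  (forall x, G (x + 2) = G x) ->
  (\int[mu01 R]_x (G x + G (- x)%R) =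
   \int[mu01 R]_x (G (y + x)%R + G (y - x)%R))%E.
Proof.
move=> y01 mG G0 per.
have mGN : measurable_fun [set: T] (fun x => G (- x)) by exact: measurableT_comp.
have mGa : measurable_fun [set: T] (fun x => G (y + x)).
  by apply: measurableT_comp => //; exact: measurable_funD.
have mGs : measurable_fun [set: T] (fun x => G (y - x)).
  by apply: measurableT_comp => //; exact: measurable_funB.
rewrite !ge0_integralD//.
by rewrite !integral_mu01// (@ge0_integral_periodic _ _ y).
Qed.

Lemma ae_mu01 (P : R -> Prop) : (forall x, 0 <= x <= 1 -> P x) ->
  \forall x \ae mu01 R, P x.
Proof.
move=> P01; exists (~` `[0, 1]); split => //; [exact: measurableC|exact: mu01_setC|].
by apply: subsetC => x /=; rewrite in_itv/=; exact: P01.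
Qed.

Lemma mu01_setT : mu01 R [set: T] = 1%E.
Proof.
by rewrite /mu01/= /mrestr setTI lebesgue_measure_itv/= lte_fin ltr01 -EFinB subr0.
Qed.

(** A second name for [mu01], to carry the finite-measure structure under which Tonelli is
    applied. *)
Definition mu01_finite : set T -> \bar R := mu01 R.

HB.instance Definition _ := Measure.on mu01_finite.

Let mu01_fin_num_fun : fin_num_fun mu01_finite.
Proof.
move=> A mA; rewrite ge0_fin_numE ?measure_ge0//.
apply: (@le_lt_trans _ _ (mu01 R [set: T])); last by rewrite mu01_setT ltry.
by apply: le_measure; rewrite ?inE.
Qed.

HB.instance Definition _ := Measure_isFinite.Build _ _ _ mu01_finite mu01_fin_num_fun.

Lemma bounded_integrable_mu01 (f : T -> R) (M : R) : measurable_fun [set: T] f ->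
  (forall x, `|f x| <= M) -> (mu01 R).-integrable [set: T] (EFin \o f).
Proof.
move=> mf fM; apply: measurable_bounded_integrable => //.
  by rewrite mu01_setT ltry.
exists M; split; first exact: num_real.
by move=> x Mx y _; exact: le_trans (fM y) (ltW Mx).
Qed.

Lemma continuous_integrable_mu01 (f : R -> R) : continuous f ->
  (mu01 R).-integrable [set: T] (EFin \o f).
Proof.
move=> cf.
have mf : measurable_fun [set: T] f by exact: continuous_measurable_fun.
have : mu.-integrable `[0, 1] (EFin \o f).
  apply: continuous_compact_integrable; first exact: segment_compact.
  exact: continuous_subspaceT.
move=> /integrableP[_ ifin]; apply/integrableP; split; first exact/measurable_EFinP.
by rewrite integral_mu01//; apply: measurableT_comp => //; exact/measurable_EFinP.
Qed.

End unit_interval.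

(** * Orthogonality of cosines and sines on [0,1] *)

Section orthogonality.
Context {R : realType}.
Local Notation mu := (@lebesgue_measure R).
Local Notation T := (measurableTypeR R).
Implicit Types (f g : R -> R) (e : nat -> R -> R) (a : nat -> R).

Lemma continuous_lincomb e a n : (forall k, continuous (e k)) ->
  continuous (fun x => \sum_(k < n) a k * e k x).
Proof.
move=> ce; elim: n => [|n IH] x.
  under eq_fun do rewrite big_ord0; exact: cvg_cst.
under eq_fun do rewrite big_ord_recr /=.
by apply: cvgD; [exact: IH|apply: cvgM; [exact: cvg_cst|exact: ce]].
Qed.

Lemma integrable_lincomb e a n g :
  (forall k, (mu01 R).-integrable [set: T] (EFin \o (fun x => e k x * g x))) ->
  (mu01 R).-integrable [set: T] (EFin \o (fun x => (\sum_(k < n) a k * e k x) * g x)).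
Proof.
move=> ieg; elim: n => [|n IH].
  rewrite (_ : EFin \o _ = cst 0%E); first exact: integrable0.
  by apply/funext => x /=; rewrite big_ord0 mul0r.
have := integrableD measurableT IH (integrableZl measurableT (a n) (ieg n)).
congr (integrable _ _ _); apply/funext => x.
by rewrite /= -EFinM -EFinD big_ord_recr/= mulrDl mulrA.
Qed.

Lemma Rintegral_lincomb e a n g :
  (forall k, (mu01 R).-integrable [set: T] (EFin \o (fun x => e k x * g x))) ->
  \int[mu01 R]_x ((\sum_(k < n) a k * e k x) * g x) =
  \sum_(k < n) a k * \int[mu01 R]_x (e k x * g x).
Proof.
move=> ieg; elim: n => [|n IH].
  rewrite big_ord0 -[RHS](Rintegral_set0 (mu01 R) (cst 0)) /Rintegral.
  rewrite integral_set0; under eq_integral do rewrite big_ord0 mul0r.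
  by rewrite integral0.
rewrite big_ord_recr/= -IH -RintegralZl// -RintegralD//.
- by apply: eq_Rintegral => x _; rewrite big_ord_recr/= mulrDl mulrA.
- exact: integrable_lincomb.
- exact: (integrableZl measurableT (a n) (ieg n)).
Qed.

(** Finite Parseval identity. The squared norms [c] are left free because [psi 0] is zero, so the
    sine family is orthogonal but not orthonormal. *)
Lemma Rintegral_lincomb_sqr e a (c : nat -> R) n : (forall k, continuous (e k)) ->
  (forall j k, \int[mu01 R]_x (e j x * e k x) = c k *+ (j == k)) ->
  \int[mu01 R]_x ((\sum_(k < n) a k * e k x) ^+ 2) = \sum_(k < n) a k ^+ 2 * c k.
Proof.
move=> ce orth.
under eq_Rintegral do rewrite expr2.
have ie g k : continuous g ->
    (mu01 R).-integrable [set: T] (EFin \o (fun x => e k x * g x)).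
  by move=> cg; apply: continuous_integrable_mu01 => x; apply: cvgM; [exact: ce|exact: cg].
rewrite Rintegral_lincomb; last by move=> k; apply: ie; exact: continuous_lincomb.
apply: eq_bigr => k _; rewrite expr2 -mulrA; congr (_ * _).
under eq_Rintegral do rewrite mulrC.
rewrite Rintegral_lincomb; last by move=> j; exact: ie.
rewrite (bigD1 k)//= orth eqxx mulr1n big1 ?addr0// => j jk.
by rewrite orth (_ : (j == k :> nat) = false) ?mulr0n ?mulr0//; exact/negbTE.
Qed.

Lemma continuous_cosM (c : R) : continuous (fun x : R => cos (c * x)).
Proof.
move=> x; apply: continuous_comp; last exact: continuous_cos.
by apply: cvgM; [exact: cvg_cst|exact: cvg_id].
Qed.

Lemma continuous_sinM (c : R) : continuous (fun x : R => sin (c * x)).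
Proof.
move=> x; apply: continuous_comp; last exact: continuous_sin.
by apply: cvgM; [exact: cvg_cst|exact: cvg_id].
Qed.

Lemma sin_natpi k : sin (k%:R * pi) = 0 :> R.
Proof.
elim: k => [|k IH]; first by rewrite mul0r sin0.
by rewrite -natr1 mulrDl mul1r sinDpi IH oppr0.
Qed.

Lemma Rintegral_cos_natpi k :
  \int[mu01 R]_x cos (k%:R * pi * x) = (k == 0%N)%:R :> R.
Proof.
rewrite /Rintegral integral_mu01; last first.
  apply/measurable_EFinP; apply: continuous_measurable_fun.
  exact: continuous_cosM.
have [->|k0] := eqVneq k 0%N.
  under eq_integral do rewrite mul0r mul0r cos0.
  by rewrite integral_cst//= lebesgue_measure_itv/= lte_fin ltr01 -EFinB -EFinM subr0 mulr1.
set c := k%:R * pi.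
have c0 : c != 0 by rewrite mulf_neq0 ?pnatr_eq0// (lt0r_neq0 (pi_gt0 R)).
pose F x := c^-1 * sin (c * x).
have dF (x : R) : is_derive x 1 F (cos (c * x)).
  have h : is_derive x 1 (c *: (id : R -> R^o)) (c *: 1).
    exact: is_deriveZ.
  have -> : cos (c * x) = c^-1 *: (cos ((c *: (id : R -> R^o)) x) * (c *: 1)).
    change (cos (c * x) = c^-1 * (cos (c * x) * (c * 1))).
    by rewrite mulr1 mulrCA mulVf ?mulr1.
  exact: (@is_deriveZ _ _ _ (sin \o (c *: (id : R -> R^o))) c^-1 x 1 _ (is_derive1_comp (is_derive_sin _) h)).
rewrite (@continuous_FTC2 _ _ F)//.
- by rewrite -EFinB /= /F mulr0 sin0 mulr0 mulr1 sin_natpi mulr0 subrr.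
- exact/continuous_subspaceT/continuous_cosM.
- split.
  + by move=> x _; exact: ex_derive.
  + apply: cvg_at_right_filter; apply: cvgM; [exact: cvg_cst|exact: continuous_sinM].
  + apply: cvg_at_left_filter; apply: cvgM; [exact: cvg_cst|exact: continuous_sinM].
- by move=> x _; rewrite derive1E; exact: derive_val.
Qed.

(** The sine companion of [phi]: translates of cosines are combinations of both families, see
    [phiD]. *)
Definition psi k (x : R) := Num.sqrt 2 * sin (k%:R * pi * x).

Lemma continuous_psi k : continuous (psi k).
Proof. by move=> x; apply: cvgM; [exact: cvg_cst|exact: continuous_sinM]. Qed.

Let sqrt22 : Num.sqrt 2 * Num.sqrt 2 = 2 :> R.
Proof. by rewrite -expr2 sqr_sqrtr. Qed.

Let cos_sub j k x : cos (j%:R * pi * x - k%:R * pi * x) = cos ((`|j - k|%N)%:R * pi * x) :> R.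
Proof.
rewrite -2!mulrBl; case: (leqP k j) => jk.
  by rewrite distnEl// natrB.
by rewrite distnEr ?(ltnW jk)// natrB ?(ltnW jk)// -[in RHS]opprB !mulNr cosN.
Qed.

Let cos_add j k x : cos ((j + k)%:R * pi * x) =
  cos (j%:R * pi * x) * cos (k%:R * pi * x) -
  sin (j%:R * pi * x) * sin (k%:R * pi * x) :> R.
Proof. by rewrite -cosD natrD; congr cos; ring. Qed.

Let int_cosD (s : R) p q :
  \int[mu01 R]_x (cos (p%:R * pi * x) + s * cos (q%:R * pi * x)) =
  (p == 0%N)%:R + s * (q == 0%N)%:R.
Proof.
rewrite RintegralD//.
- rewrite RintegralZl//; last exact/continuous_integrable_mu01/continuous_cosM.
  by rewrite !Rintegral_cos_natpi.
- exact/continuous_integrable_mu01/continuous_cosM.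
- apply: continuous_integrable_mu01 => x.
  by apply: cvgM; [exact: cvg_cst|exact: continuous_cosM].
Qed.

(** Product-to-sum leaves cosines of frequencies [|j - k|] and [j + k], and only frequency 0 has a
    nonzero integral. *)
Lemma phi_orthonormal j k :
  \int[mu01 R]_x (phi j x * phi k x) = 1 *+ (j == k) :> R.
Proof.
have phi0 l (x : R) : phi l.+1 x = Num.sqrt 2 * cos (l.+1%:R * pi * x) by [].
have phi00 (x : R) : phi 0 x = 1 by [].
have int0 l : \int[mu01 R]_x phi l.+1 x = 0 :> R.
  under eq_Rintegral do rewrite phi0.
  rewrite RintegralZl//; last exact/continuous_integrable_mu01/continuous_cosM.
  by rewrite Rintegral_cos_natpi mulr0.
case: j => [|j]; case: k => [|k].
- under eq_Rintegral do rewrite phi00 mulr1.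
  by rewrite Rintegral_cst// mu01_setT mul1r.
- by under eq_Rintegral do rewrite phi00 mul1r; rewrite int0.
- by under eq_Rintegral do rewrite phi00 mulr1; rewrite int0.
under eq_Rintegral => x _.
  rewrite !phi0 mulrACA sqrt22.
  rewrite (_ : 2 * _ = cos ((`|j.+1 - k.+1|%N)%:R * pi * x) +
      1 * cos ((j.+1 + k.+1)%:R * pi * x)); last first.
    by rewrite -cos_sub cos_add cosB; ring.
  over.
rewrite int_cosD addSn mulr0 addr0 distn_eq0 eqSS.
by case: eqP.
Qed.

Lemma psi_orthogonal j k :
  \int[mu01 R]_x (psi j x * psi k x) = ((k != 0%N)%:R : R) *+ (j == k).
Proof.
under eq_Rintegral => x _.
  rewrite /psi mulrACA sqrt22.
  rewrite (_ : 2 * _ = cos ((`|j - k|%N)%:R * pi * x) + -1 * cos ((j + k)%:R * pi * x)); last first.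
    by rewrite -cos_sub cos_add cosB; ring.
  over.
rewrite int_cosD distn_eq0 addn_eq0.
have [->|jk] := eqVneq j k; last first.
  by rewrite mulr0n; case: j jk => [|j]; case: k => [|k]//= _; rewrite mulr0 addr0.
by rewrite andbb; case: k => [|k] /=; rewrite mulr1n; ring.
Qed.

End orthogonality.

(** * Diagonalisation of the fractional Sobolev form *)

Section sobolev_kernel.
Context {R : realType}.
Local Notation mu := (@lebesgue_measure R).
Local Notation T := (measurableTypeR R).
Variable s : R.

Definition sob_weight (t : R) : R := (`|sin (pi * t / 2)| `^ s)^-1.

Lemma sob_weight_ge0 t : 0 <= sob_weight t.
Proof. by rewrite invr_ge0 powR_ge0. Qed.

Lemma sob_weightN t : sob_weight (- t) = sob_weight t.
Proof. by rewrite /sob_weight mulrN mulNr sinN normrN. Qed.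

Lemma sob_weightD2 t : sob_weight (t + 2) = sob_weight t.
Proof.
rewrite /sob_weight (_ : pi * (t + 2) / 2 = pi * t / 2 + pi); last by field.
by rewrite sinDpi normrN.
Qed.

Lemma measurable_sob_weight : measurable_fun [set: T] sob_weight.
Proof.
have mpow : measurable_fun [set: T] (fun t : T => `|sin (pi * t / 2)| `^ s).
  apply: (measurableT_comp (measurable_powR s)).
  apply: measurableT_comp => //; apply: continuous_measurable_fun => x.
  apply: continuous_comp; last exact: continuous_sin.
  apply: cvgM; last exact: cvg_cst.
  by apply: cvgM; [exact: cvg_cst|exact: cvg_id].
have -> : sob_weight = (fun t => `|sin (pi * t / 2)| `^ (- s)).
  by apply/funext => t; rewrite powRN.
apply: (measurableT_comp (measurable_powR (- s))).
apply: measurableT_comp => //; apply: continuous_measurable_fun => x.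
apply: continuous_comp; last exact: continuous_sin.
apply: cvgM; last exact: cvg_cst.
by apply: cvgM; [exact: cvg_cst|exact: cvg_id].
Qed.

(* The weight of [phi k] in the diagonalised form, up to the factor
   [(1 - alpha) pi^3 / 8]: [4 (1 - cos (k pi h))] is the squared [L2] norm of the
   increments of [phi k] by [h] and [-h], see [Rintegral_increments]. *)
Definition sob_eig (k : nat) : \bar R :=
  (\int[mu01 R]_h (4 * (1 - cos (k%:R * pi * h)) * sob_weight h)%:E)%E.

Lemma phiN k (x : R) : phi k (- x) = phi k x.
Proof. by rewrite /phi mulrN cosN. Qed.

Lemma phiD2 k (x : R) : phi k (x + 2) = phi k x.
Proof.
rewrite /phi; case: eqP => // _; congr (_ * _).
rewrite (_ : k%:R * pi * (x + 2) = k%:R * pi * x + (pi *+ 2) *+ k).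
  exact: (periodicn (@cosD2pi R)).
by rewrite -mulrnA -(mulr_natl pi) natrM; ring.
Qed.

Lemma phiD k (x h : R) :
  phi k (x + h) = cos (k%:R * pi * h) * phi k x - sin (k%:R * pi * h) * psi k x.
Proof.
rewrite /phi /psi; case: eqP => [->|_]; first by rewrite !mul0r cos0 sin0 mul0r mul1r subr0.
by rewrite mulrDr cosD; ring.
Qed.

Variables (n : nat) (a : nat -> R).
Let f (x : R) := \sum_(k < n) a k * phi k x.

Let fN x : f (- x) = f x.
Proof. by apply: eq_bigr => k _; rewrite phiN. Qed.

Let fD2 x : f (x + 2) = f x.
Proof. by apply: eq_bigr => k _; rewrite phiD2. Qed.

Let cf : continuous f.
Proof. by apply: continuous_lincomb => k; exact: continuous_phi. Qed.

Let mf : measurable_fun [set: T] f.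
Proof. exact: continuous_measurable_fun. Qed.

(* The increments by [h] and [-h] are [A - S] and [A + S], so the cross terms
   cancel and orthogonality within each of the two families suffices. *)
Lemma Rintegral_increments h :
  \int[mu01 R]_y ((f (y + h) - f y) ^+ 2 + (f (y - h) - f y) ^+ 2) =
  \sum_(k < n) a k ^+ 2 * (4 * (1 - cos (k%:R * pi * h))).
Proof.
pose A (y : R) := \sum_(k < n) (a k * (cos (k%:R * pi * h) - 1)) * phi k y.
pose S (y : R) := \sum_(k < n) (a k * sin (k%:R * pi * h)) * psi k y.
have fA y : f (y + h) - f y = A y - S y.
  rewrite /f /A /S -!sumrB; apply: eq_bigr => k _; rewrite phiD; ring.
have fS y : f (y - h) - f y = A y + S y.
  rewrite /f /A /S -sumrB -big_split; apply: eq_bigr => k _.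
  by rewrite phiD mulrN sinN cosN /=; ring.
have cA : continuous A.
  apply: (@continuous_lincomb _ _ (fun k => a k * (cos (k%:R * pi * h) - 1))) => k; exact: continuous_phi.
have cS : continuous S.
  apply: (@continuous_lincomb _ _ (fun k => a k * sin (k%:R * pi * h))) => k; exact: continuous_psi.
have cA2 : continuous (fun y => 2 * A y ^+ 2).
  move=> y; apply: cvgM; first exact: cvg_cst.
  by under eq_fun do rewrite expr2; apply: cvgM; exact: cA.
have cS2 : continuous (fun y => 2 * S y ^+ 2).
  move=> y; apply: cvgM; first exact: cvg_cst.
  by under eq_fun do rewrite expr2; apply: cvgM; exact: cS.
have sqr_cont (g : R -> R) : continuous g -> continuous (fun y => g y ^+ 2).
  by move=> cg y; under eq_fun do rewrite expr2; apply: cvgM; exact: cg.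
transitivity (\int[mu01 R]_y (2 * A y ^+ 2 + 2 * S y ^+ 2)).
  by apply: eq_Rintegral => y _; rewrite fA fS; ring.
rewrite RintegralD//; [|exact: continuous_integrable_mu01..].
rewrite !RintegralZl//; [|exact/continuous_integrable_mu01/sqr_cont..].
have -> := @Rintegral_lincomb_sqr _ _ (fun k => a k * (cos (k%:R * pi * h) - 1))
  _ n (@continuous_phi R) phi_orthonormal.
have -> := @Rintegral_lincomb_sqr _ _ (fun k => a k * sin (k%:R * pi * h))
  _ n (@continuous_psi R) psi_orthogonal.
rewrite !mulr_sumr -big_split; apply: eq_bigr => k _ /=.
(* For [k = 0] both sides vanish, whatever the norm of [psi 0]; otherwise
   [2 (c - 1)^2 + 2 d^2 = 4 (1 - c)] because [c^2 + d^2 = 1]. *)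
case: (nat_of_ord k) => [|j]; first by rewrite !mul0r cos0 sin0; ring.
have := cos2Dsin2 (j.+1%:R * pi * h); set c := cos _; set d := sin _ => cd.
have dE : d ^+ 2 = 1 - c ^+ 2 by rewrite -cd addrAC subrr add0r.
by rewrite !exprMn dE /=; ring.
Qed.

Let K (x y : R) : R :=
  (f x - f y) ^+ 2 * sob_weight (x - y) + (f x - f y) ^+ 2 * sob_weight (x + y).

Let K_ge0 x y : 0 <= K x y.
Proof. by rewrite addr_ge0// mulr_ge0 ?sqr_ge0 ?sob_weight_ge0. Qed.

Let H (h y : R) : R :=
  sob_weight h * ((f (y + h) - f y) ^+ 2 + (f (y - h) - f y) ^+ 2).

Let H_ge0 h y : 0 <= H h y.
Proof. by rewrite mulr_ge0 ?sob_weight_ge0// addr_ge0 ?sqr_ge0. Qed.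

Let K_ge0E z : (0 <= (K z.1 z.2)%:E)%E. Proof. by rewrite lee_fin. Qed.

Let H_ge0E z : (0 <= (H z.1 z.2)%:E)%E. Proof. by rewrite lee_fin. Qed.

Let msqr y : measurable_fun [set: T] (fun x => (f x - f y) ^+ 2).
Proof. by apply: measurable_funX; exact: measurable_funB. Qed.

(** Since [f] and the weight are even, the two kernels contribute [G x] and [G (- x)] for a single
    2-periodic [G]. The integral thus covers a full period, which may be centred at [y] instead of
    0. *)
Lemma integral_kernel_recentre y : 0 <= y <= 1 ->
  (\int[mu01 R]_x (K x y)%:E = \int[mu01 R]_h (H h y)%:E)%E.
Proof.
move=> y01.
pose G x := ((f x - f y) ^+ 2 * sob_weight (x - y))%:E.
have G0 x : (0 <= G x)%E by rewrite lee_fin mulr_ge0 ?sqr_ge0 ?sob_weight_ge0.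
have mG : measurable_fun [set: T] G.
  apply/measurable_EFinP; apply: measurable_funM; first exact: msqr.
  apply: (measurableT_comp measurable_sob_weight).
  exact: measurable_funB.
have Gper x : G (x + 2) = G x.
  by rewrite /G fD2 addrAC sob_weightD2.
have KE (x : R) : (K x y)%:E = (G x + G (- x)%R)%E.
  by rewrite /G -EFinD fN -opprD sob_weightN.
have HE (x : R) : (H x y)%:E = (G (y + x)%R + G (y - x)%R)%E.
  rewrite /G -EFinD (addrC y x) addrK (_ : y - x - y = - x); last by ring.
  by rewrite sob_weightN /H (addrC x y); congr EFin; ring.
transitivity (\int[mu01 R]_x (G x + G (- x)%R))%E; first exact: eq_integral.
transitivity (\int[mu01 R]_x (G (y + x)%R + G (y - x)%R))%E; last first.
  by apply: eq_integral => x _; rewrite HE.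
exact: ge0_integral_mu01_periodic.
Qed.

Let measurable_K : measurable_fun [set: T * T] (fun z => (K z.1 z.2)%:E).
Proof.
apply/measurable_EFinP.
have m1 : measurable_fun [set: T * T] (fun z => f z.1) by exact: measurableT_comp.
have m2 : measurable_fun [set: T * T] (fun z => f z.2) by exact: measurableT_comp.
have msq : measurable_fun [set: T * T] (fun z => (f z.1 - f z.2) ^+ 2).
  by apply: measurable_funX; exact: measurable_funB.
apply: measurable_funD; apply: measurable_funM => //.
  apply: (measurableT_comp measurable_sob_weight).
  by apply: measurable_funB; [exact: measurable_fst|exact: measurable_snd].
apply: (measurableT_comp measurable_sob_weight).
by apply: measurable_funD; [exact: measurable_fst|exact: measurable_snd].
Qed.

Let measurable_H : measurable_fun [set: T * T] (fun z => (H z.1 z.2)%:E).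
Proof.
apply/measurable_EFinP.
have m2 : measurable_fun [set: T * T] (fun z => f z.2) by exact: measurableT_comp.
apply: measurable_funM.
  by apply: (measurableT_comp measurable_sob_weight); exact: measurable_fst.
apply: measurable_funD; apply: measurable_funX; apply: measurable_funB => //.
  apply: (measurableT_comp mf).
  by apply: measurable_funD; [exact: measurable_snd|exact: measurable_fst].
apply: (measurableT_comp mf).
by apply: measurable_funB; [exact: measurable_snd|exact: measurable_fst].
Qed.

Local Notation m01 := (@mu01_finite R).

Lemma integral_increments h :
  (\int[mu01 R]_y (H h y)%:E =
   \sum_(k < n) (a k ^+ 2)%:E * (4 * (1 - cos (k%:R * pi * h)) * sob_weight h)%:E)%E.
Proof.
have cinc : continuous (fun y => (f (y + h) - f y) ^+ 2 + (f (y - h) - f y) ^+ 2).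
  have cshift c : continuous (fun y => (f (y + c) - f y) ^+ 2).
    move=> y; under eq_fun do rewrite expr2.
    have c1 : {for y, continuous (fun y => f (y + c) - f y)}.
      apply: cvgB; last exact: cf.
      apply: continuous_comp; last exact: cf.
      by apply: cvgD; [exact: cvg_id|exact: cvg_cst].
    exact: cvgM.
  by move=> y; apply: cvgD; exact: cshift.
transitivity (sob_weight h *
    \int[mu01 R]_y ((f (y + h) - f y) ^+ 2 + (f (y - h) - f y) ^+ 2))%:E.
  rewrite -RintegralZl//; last exact: continuous_integrable_mu01.
  rewrite /Rintegral fineK//; apply: integrable_fin_num => //.
  apply: continuous_integrable_mu01 => y.
  by apply: cvgM; [exact: cvg_cst|exact: cinc].
rewrite Rintegral_increments mulr_sumr sumEFin; congr EFin.
by apply: eq_bigr => k _; ring.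
Qed.

Let term_ge0 k h : 0 <= 4 * (1 - cos (k%:R * pi * h)) * sob_weight h.
Proof. by rewrite !mulr_ge0 ?sob_weight_ge0 ?subr_ge0 ?cos_le1. Qed.

Let measurable_term k :
  measurable_fun [set: T] (fun h : T => 4 * (1 - cos (k%:R * pi * h)) * sob_weight h).
Proof.
apply: measurable_funM; last exact: measurable_sob_weight.
apply: continuous_measurable_fun => x; apply: cvgM; first exact: cvg_cst.
by apply: cvgB; [exact: cvg_cst|exact: continuous_cosM].
Qed.

(** Recentring holds for [y] in [[0, 1]], hence almost everywhere for [mu01]. Tonelli then makes [y]
    the inner variable; for it the weight is a constant factor, and orthogonality evaluates the
    squared increments. *)
Lemma integral_kernel_diag :
  (\int[mu01 R]_y \int[mu01 R]_x (K x y)%:E =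
   \sum_(k < n) (a k ^+ 2)%:E * sob_eig k)%E.
Proof.
transitivity (\int[mu01 R]_y \int[mu01 R]_h (H h y)%:E)%E.
  apply: ge0_ae_eq_integral => //.
  - exact: (@measurable_fun_fubini_tonelli_G _ _ _ _ _ m01 _ measurable_K K_ge0E).
  - exact: (@measurable_fun_fubini_tonelli_G _ _ _ _ _ m01 _ measurable_H H_ge0E).
  - by move=> y _; apply: integral_ge0 => x _; rewrite lee_fin.
  - by move=> y _; apply: integral_ge0 => x _; rewrite lee_fin.
  - by apply: ae_mu01 => y y01 _; exact: integral_kernel_recentre.
transitivity (\int[mu01 R]_h \int[mu01 R]_y (H h y)%:E)%E.
  apply/esym/(@fubini_tonelli _ _ _ _ _ m01 m01 (fun z => (H z.1 z.2)%:E)) => //.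
under eq_integral do rewrite integral_increments.
rewrite ge0_integral_sum//; last 2 first.
- move=> k; apply: emeasurable_funM => //; exact/measurable_EFinP.
- by move=> k h _; rewrite mule_ge0// lee_fin ?sqr_ge0.
apply: eq_bigr => k _; rewrite ge0_integralZl//; first exact/measurable_EFinP.
- by move=> h _; rewrite lee_fin.
- by rewrite lee_fin sqr_ge0.
Qed.

(** With finite eigenvalues the outer integral is finite, so the inner one is finite for almost
    every [y], and no infinite value is silently replaced by 0 in the real integrals. *)
Lemma Rintegral_kernel_diag : (forall k, sob_eig k < +oo)%E ->
  \int[mu01 R]_y \int[mu01 R]_x K x y = \sum_(k < n) a k ^+ 2 * fine (sob_eig k).
Proof.
move=> eigfin.
have eig0 k : (0 <= sob_eig k)%E by apply: integral_ge0 => h _; rewrite lee_fin.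
have eigE k : ((fine (sob_eig k))%:E = sob_eig k)%E.
  by rewrite fineK// ge0_fin_numE.
have diag : (\int[mu01 R]_y \int[mu01 R]_x (K x y)%:E =
    (\sum_(k < n) a k ^+ 2 * fine (sob_eig k))%:E)%E.
  rewrite integral_kernel_diag -sumEFin; apply: eq_bigr => k _.
  by rewrite [RHS]EFinM eigE.
have mJ := @measurable_fun_fubini_tonelli_G _ _ _ _ _ m01 _ measurable_K K_ge0E.
have J0 y : (0 <= \int[mu01 R]_x (K x y)%:E)%E.
  by apply: integral_ge0 => x _; rewrite lee_fin.
have iJ : (mu01 R).-integrable [set: T] (fun y => \int[mu01 R]_x (K x y)%:E)%E.
  apply/integrableP; split; first exact: mJ.
  by under eq_integral do rewrite gee0_abs//; rewrite diag ltry.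
rewrite {1}/Rintegral -[RHS]/(fine (_%:E)) -diag; congr fine.
apply: ge0_ae_eq_integral => //.
- by apply/measurable_EFinP; apply: (measurableT_comp (fine_measurable measurableT)).
- by move=> y _; rewrite lee_fin fine_ge0.
- have := integrable_ae measurableT iJ; apply: filterS => y /(_ I) yfin _.
  by rewrite /= fineK.
Qed.

End sobolev_kernel.

(** * Growth of the eigenvalues *)

Section trigonometric_bounds.
Context {R : realType}.

Lemma sin_le_id (x : R) : 0 <= x -> sin x <= x.
Proof.
move=> x0; have [|c _] := @MVT_segment _ sin cos 0 x x0 (fun y _ => is_derive_sin y).
  exact/continuous_subspaceT/continuous_sin.
by rewrite sin0 !subr0 => ->; rewrite ler_piMl ?cos_le1.
Qed.

Lemma one_sub_cos_le_sqr (x : R) : 0 <= x -> 1 - cos x <= x ^+ 2.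
Proof.
move=> x0.
have [|c /[!in_itv]/= /andP[c0 cx]] :=
    @MVT_segment _ cos (fun y => - sin y) 0 x x0 (fun y _ => is_derive_cos y).
  exact/continuous_subspaceT/continuous_cos.
rewrite cos0 subr0 => /(congr1 -%R); rewrite opprB => ->.
rewrite mulNr opprK expr2 ler_wpM2r//.
exact: le_trans (sin_le_id c0) cx.
Qed.

Lemma sin_pihalf_ge_linear :
  exists2 c : R, 0 < c & forall h, 0 <= h <= 1 -> c * h <= sin (pi * h / 2).
Proof.
have pi1 := pihalf_ge1 R; have pi2 := pihalf_lt2 R.
have cos1 := @cos1_gt0 R.
have sin1 : 0 < sin 1 :> R by apply: sin2_gt0; rewrite ltr01 ltr1n.
(* With [u = pi h / 2 >= h]: for [u <= 1] the mean value theorem gives [sin u >= u cos 1]; for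
   [u > 1] monotonicity up to [pi / 2] gives [sin u >= sin 1], and [h <= 1]. *)
exists (Num.min (cos 1) (sin 1)); first by rewrite lt_min cos1 sin1.
move=> h /andP[h0 h1].
set u := pi * h / 2.
have uE : u = pi / 2 * h by rewrite /u; ring.
have hu : h <= u by rewrite uE ler_peMl.
have u0 : 0 <= u := le_trans h0 hu.
have u2 : u <= pi / 2 by rewrite uE ler_piMr// (le_trans _ pi1).
have [u1|u1] := leP u 1.
  have [|c /[!in_itv]/= /andP[c0 cu]] :=
      @MVT_segment _ sin cos 0 u u0 (fun y _ => is_derive_sin y).
    exact/continuous_subspaceT/continuous_sin.
  rewrite sin0 !subr0 => ->.
  apply: ler_pM => //; first by rewrite ltW// lt_min cos1 sin1.
  rewrite ge_min; apply/orP; left.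
  have cI : c \in `[0, pi] by rewrite in_itv/=; apply/andP; split => //; lra.
  have I1 : (1 : R) \in `[0, pi] by rewrite in_itv/=; apply/andP; split => //; lra.
  by rewrite leNgt (ltr_cos I1 cI) -leNgt (le_trans cu).
apply: (@le_trans _ _ (sin 1)).
  rewrite -[leRHS]mulr1 ler_pM//; first by rewrite ltW// lt_min cos1 sin1.
  by rewrite ge_min lexx orbT.
have uI : u \in `[- (pi / 2), pi / 2] by rewrite in_itv/=; apply/andP; split => //; lra.
have I1 : (1 : R) \in `[- (pi / 2), pi / 2].
  by rewrite in_itv/=; apply/andP; split => //; lra.
by rewrite leNgt (ltr_sin uI I1) -leNgt ltW.
Qed.

Lemma cos_le0_pihalf (x : R) : pi / 2 <= x <= pi -> cos x <= 0.
Proof.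
move=> /andP[x1 x2]; rewrite -(subrK (pi / 2) x) cosDpihalf oppr_le0.
by apply: sin_ge0_pi; have := pi_ge0 R; move=> p0; apply/andP; split; lra.
Qed.

End trigonometric_bounds.

Section integral_powR.
Context {R : realType}.
Local Notation mu := (@lebesgue_measure R).
Local Notation T := (measurableTypeR R).

Lemma integral_powR_itv (p a b : R) : 0 < a -> a <= b -> p + 1 != 0 ->
  (\int[mu]_(x in `[a, b]) (x `^ p)%:E =
   ((b `^ (p + 1) - a `^ (p + 1)) / (p + 1))%:E)%E.
Proof.
move=> a0; rewrite le_eqVlt => /predU1P[<-|ab] p1.
  by rewrite set_itv1 integral_set1 subrr mul0r.
pose F x := (p + 1)^-1 * x `^ (p + 1).
have dpow (q x : R) : 0 < x -> is_derive x 1 (@powR R ^~ q) (q * x `^ (q - 1)).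
  by move=> x0; exact: is_derive1_powR.
have dF (x : R) : 0 < x -> is_derive x 1 F (x `^ p).
  move=> x0.
  have -> : x `^ p = (p + 1)^-1 *: ((p + 1) * x `^ ((p + 1) - 1)).
    by rewrite /GRing.scale/= mulrA mulVf// mul1r addrK.
  exact: (@is_deriveZ _ _ _ (@powR R ^~ (p + 1)) _ _ _ _ (dpow _ _ x0)).
have cpos (G : R -> R) : (forall x, 0 < x -> derivable G x 1) ->
    forall x, 0 < x -> {for x, continuous G}.
  by move=> dG x x0; apply/differentiable_continuous/derivable1_diffP/dG.
have cF x : 0 < x -> {for x, continuous F}.
  by apply: cpos => y y0; have := dF y y0 => ?; exact: ex_derive.
rewrite (@continuous_FTC2 _ _ F)//.
- by rewrite -EFinB /F -mulrBr mulrC.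
- apply: derivable_within_continuous => x; rewrite in_itv/= => /andP[ax _].
  by have := dpow p x (lt_le_trans a0 ax) => ?; exact: ex_derive.
- split.
  + move=> x; rewrite in_itv/= => /andP[ax _].
    by have := dF x (lt_trans a0 ax) => ?; exact: ex_derive.
  + exact/cvg_at_right_filter/cF.
  + exact/cvg_at_left_filter/cF/(lt_trans a0).
- move=> x; rewrite in_itv/= => /andP[ax _].
  have := dF x (lt_trans a0 ax) => ?.
  by rewrite derive1E; exact: derive_val.
Qed.

(** The power may be singular at 0, so the interval is exhausted by the intervals
    [[b / (n + 1), b]]: on each the antiderivative gives the bound after dropping the lower
    endpoint, and monotone convergence passes to the limit. *)
Lemma integral_powR_at0_le (p b : R) : 0 < b -> 0 < p + 1 ->
  (\int[mu]_(x in `]0%R, b]) (x `^ p)%:E <= (b `^ (p + 1) / (p + 1))%:E)%E.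
Proof.
move=> b0 p1.
pose F (n : nat) : set T := `[(b / n.+1%:R)%R, b]%classic.
have bn n : 0 < b / n.+1%:R by rewrite divr_gt0.
have FE : \bigcup_n F n = `]0%R, b]%classic.
  apply/seteqP; split => x.
    by move=> [n _]; rewrite /F /= !in_itv/= => /andP[nx ->]; rewrite (lt_le_trans (bn n) nx).
  rewrite /= in_itv/= => /andP[x0 xb].
  have [k] := @ltr_add_invr R 0 (x / b) (divr_gt0 x0 b0).
  rewrite add0r => kx; exists k => //=; rewrite /F/= in_itv/= xb andbT ltW//.
  by move: kx; rewrite ltr_pdivlMr// mulrC.
rewrite -FE.
have mp : measurable_fun [set: T] (fun x : T => (x `^ p)%:E).
  by apply/measurable_EFinP; exact: measurable_powR.
have cv := @ge0_nondecreasing_set_cvg_integral _ _ _ F (fun x : T => (x `^ p)%:E) mu.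
rewrite -(cvg_lim _ (cv _ _ _ _))//; last 4 first.
- move=> m n mn; apply/subsetPset => x; rewrite /F/= !in_itv/= => /andP[mx ->].
  rewrite andbT (le_trans _ mx)// ler_wpM2l ?(ltW b0)// lef_pV2 ?posrE//.
  by rewrite ler_nat.
- by move=> n; exact: measurable_itv.
- by move=> n; exact: measurable_funS mp.
- by move=> n x _; rewrite lee_fin powR_ge0.
apply: lime_le.
  apply/cvg_ex; eexists; apply: cv.
  - move=> m n mn; apply/subsetPset => x; rewrite /F/= !in_itv/= => /andP[mx ->].
    rewrite andbT (le_trans _ mx)// ler_wpM2l ?(ltW b0)// lef_pV2 ?posrE//.
    by rewrite ler_nat.
  - by move=> n; exact: measurable_itv.
  - by move=> n; exact: measurable_funS mp.
  - by move=> n x _; rewrite lee_fin powR_ge0.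
apply: nearW => n.
rewrite integral_powR_itv ?lt0r_neq0//; last first.
  by rewrite ler_pdivrMr// ler_peMr ?(ltW b0)// ler1n.
rewrite lee_fin ler_wpM2r ?invr_ge0 ?(ltW p1)//.
by rewrite gerBl powR_ge0.
Qed.

End integral_powR.

Section sob_eig_bounds.
Context {R : realType}.
Local Notation mu := (@lebesgue_measure R).
Local Notation T := (measurableTypeR R).
Variable alpha : R.
Hypothesis halpha : 1 / 2 < alpha < 1.
Local Notation s := (2 * alpha + 1).

Let term k (h : T) : R := 4 * (1 - cos (k%:R * pi * h)) * sob_weight s h.

Let term_ge0 k h : 0 <= term k h.
Proof. by rewrite /term !mulr_ge0 ?sob_weight_ge0 ?subr_ge0 ?cos_le1. Qed.

Let measurable_term k : measurable_fun [set: T] (fun h => (term k h)%:E).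
Proof.
apply/measurable_EFinP; apply: measurable_funM; last exact: measurable_sob_weight.
apply: continuous_measurable_fun => x; apply: cvgM; first exact: cvg_cst.
by apply: cvgB; [exact: cvg_cst|exact: continuous_cosM].
Qed.

Let sob_eigE k : (sob_eig s k = \int[mu]_(h in `[0%R, 1%R]) (term k h)%:E)%E.
Proof. exact: (integral_mu01 (measurable_term k)). Qed.

Lemma sob_eig0 : sob_eig s 0 = 0%E :> \bar R.
Proof.
rewrite sob_eigE (eq_integral (fun=> 0%E)) ?integral0// => h _.
by rewrite /term mul0r mul0r cos0 subrr mulr0 mul0r.
Qed.

Lemma sob_eig_ge0 k : (0 <= sob_eig s k :> \bar R)%E.
Proof. by apply: integral_ge0 => h _; rewrite lee_fin term_ge0. Qed.

Lemma sob_eig_ge : exists2 c : R, 0 < c &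
  forall k, (0 < k)%N -> ((c * k%:R `^ (2 * alpha))%:E <= sob_eig s k)%E.
Proof.
have /andP[a1 a2] := halpha.
have [c0 c0_gt0 sin_ge] := @sin_pihalf_ge_linear R.
(* The integrand is at least [4 (k / 2)^s] on [[1/(2k), 1/k]], whose length is [1/(2k)]. *)
exists (2 * 2 `^ (- s)); first by rewrite mulr_gt0 ?powR_gt0.
move=> k k0.
have kR : 0 < k%:R :> R by rewrite ltr0n.
have k1 : 1 <= k%:R :> R by rewrite ler1n.
have kV : 0 < k%:R^-1 :> R by rewrite invr_gt0.
have kV1 : k%:R^-1 <= 1 :> R by rewrite invf_le1.
(* On this interval the phase [k pi h] stays in [[pi / 2, pi]], where the cosine is nonpositive,
   while the sine in the weight is at most [pi h / 2 <= 2 / k]. *)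
pose J : set T := `[(k%:R^-1 / 2)%R, k%:R^-1%R]%classic.
have JE (h : R) : J h -> k%:R^-1 / 2 <= h /\ h <= k%:R^-1.
  by rewrite /J/= in_itv/= => /andP[].
have JI : J `<=` `[0%R, 1%R].
  move=> h /JE[h1 h2]; rewrite /= in_itv/=; apply/andP; split; last exact: le_trans kV1.
  by apply: le_trans h1; rewrite divr_ge0 ?(ltW kV).
rewrite sob_eigE.
apply: (@le_trans _ _ (\int[mu]_(h in J) (term k h)%:E)%E); last first.
  apply: ge0_subset_integral => //=; first exact: measurable_itv.
    exact: measurable_funS (measurable_term k).
  by move=> h _; rewrite lee_fin term_ge0.
apply: (@le_trans _ _ (\int[mu]_(h in J) (cst (4 * (k%:R / 2) `^ s)%:E) h)%E).
  rewrite integral_cst//; last exact: measurable_itv.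
  rewrite /= lebesgue_measure_itv/= lte_fin.
  have -> : k%:R^-1 / 2 < k%:R^-1 :> R by lra.
  rewrite -EFinB -EFinM lee_fin.
  rewrite powRM ?(ltW kR) ?invr_ge0//.
  have -> : k%:R `^ s = k%:R `^ (2 * alpha) * k%:R :> R.
    by rewrite powRD ?powRr1 ?(ltW kR)//; apply/implyP => _; rewrite lt0r_neq0.
  have -> : (2^-1 : R) `^ s = 2 `^ (- s) by rewrite -powR_inv1// -powRrM mulN1r.
  rewrite le_eqVlt; apply/orP; left; apply/eqP.
  by field; rewrite lt0r_neq0.
apply: ge0_le_integral => //.
- exact: measurable_itv.
- by move=> h _; rewrite /= lee_fin mulr_ge0 ?powR_ge0.
- exact: measurable_funS (measurable_term k).
move=> h /[dup] /JI; rewrite /= in_itv/= => h01 /JE[h1 h2]; rewrite lee_fin.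
have h_gt0 : 0 < h by apply: lt_le_trans h1; rewrite divr_gt0.
have := sin_ge h h01; set u := sin _ => cu.
have u0 : 0 < u by apply: lt_le_trans cu; rewrite mulr_gt0.
have u_le : u <= 2 / k%:R.
  apply: le_trans (sin_le_id _) _; first by rewrite divr_ge0 ?mulr_ge0 ?pi_ge0 ?(ltW h_gt0).
  have := pihalf_lt2 R; move: h2 h_gt0; set q := k%:R^-1; nra.
rewrite /term /sob_weight -/u ger0_norm ?(ltW u0)//.
apply: ler_pM; rewrite ?powR_ge0//.
  rewrite -[leLHS]mulr1 ler_pM2l//.
  suff : cos (k%:R * pi * h) <= 0 by lra.
  apply: cos_le0_pihalf.
  have -> : k%:R * pi * h = pi * (k%:R * h) :> R by ring.
  have p0 := pi_gt0 R.
  rewrite ler_pM2l// ler_piMr ?(ltW p0)//; last by rewrite mulrC -ler_pdivlMr// mul1r.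
  rewrite andbT; have := ler_wpM2l (ltW kR) h1.
  by rewrite mulrA divff ?lt0r_neq0// mul1r.
have -> : (k%:R / 2) `^ s = ((2 / k%:R) `^ s)^-1 :> R.
  by rewrite -powRN -mulN1r powRrM powR_inv1 ?divr_ge0 ?(ltW kR)// invf_div.
rewrite lef_pV2 ?posrE ?powR_gt0 ?divr_gt0//.
by apply: ge0_ler_powR; rewrite ?nnegrE ?(ltW u0) ?divr_ge0 ?(ltW kR)//; lra.
Qed.

Lemma sob_eig_le : exists2 C : R, 0 < C &
  forall k, (0 < k)%N -> (sob_eig s k <= (C * k%:R `^ (2 * alpha))%:E)%E.
Proof.
have /andP[a1 a2] := halpha.
have [c0 c0_gt0 sin_ge] := @sin_pihalf_ge_linear R.
have w_le h : 0 < h -> h <= 1 -> sob_weight s h <= c0 `^ (- s) * h `^ (- s).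
  move=> h0 h1; have := sin_ge h; rewrite (ltW h0) h1 => /(_ isT).
  rewrite /sob_weight; set u := sin _ => cu.
  have ch0 : 0 < c0 * h by rewrite mulr_gt0.
  rewrite -powRM ?(ltW h0) ?(ltW c0_gt0)// powRN.
  rewrite lef_pV2 ?posrE ?powR_gt0//; last by rewrite normr_gt0 lt0r_neq0// (lt_le_trans ch0).
  apply: ge0_ler_powR; rewrite ?nnegrE//; [lra|exact: ltW|].
  exact: le_trans cu (ler_norm _).
(* The integrand is at most [A k^2 h^(1 - 2 alpha)] on []0, 1/k]], by [1 - cos x <= x^2], and at
   most [B h^(- s)] on [[1/k, 1]], by [1 - cos x <= 2]. Both integrals are of order
   [k^(2 alpha)]. *)
pose A := 4 * pi ^+ 2 * c0 `^ (- s).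
pose B := 8 * c0 `^ (- s).
have p0 := pi_gt0 R.
have A0 : 0 < A by rewrite !mulr_gt0 ?powR_gt0 ?exprn_gt0.
have B0 : 0 < B by rewrite !mulr_gt0 ?powR_gt0.
exists (A / (2 - 2 * alpha) + B / (2 * alpha)).
  by rewrite addr_gt0// divr_gt0//; lra.
move=> k k0.
have kR : 0 < k%:R :> R by rewrite ltr0n.
have k1 : 1 <= k%:R :> R by rewrite ler1n.
pose b : R := k%:R^-1.
have b0 : 0 < b by rewrite invr_gt0.
have b1 : b <= 1 by rewrite invf_le1.
have bpow q : b `^ q = k%:R `^ (- q) by rewrite /b -powR_inv1 ?(ltW kR)// -powRrM mulN1r.
rewrite sob_eigE (@ge0_integral_itv_split _ _ 0 b 1) ?(ltW b0)//; last first.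
  by move=> h; rewrite lee_fin term_ge0.
rewrite mulrDl EFinD; apply: leeD.
  (* The bound [w_le] on the weight is for [h > 0], so the endpoint 0 is discarded first. *)
  rewrite -integral_itv_obnd_cbnd; last exact: measurable_funS (measurable_term k).
  apply: (@le_trans _ _ (\int[mu]_(h in `]0%R, b])
      ((A * k%:R ^+ 2)%:E * (h `^ (1 - 2 * alpha))%:E))%E).
    apply: ge0_le_integral => //=.
    - by move=> h _; rewrite lee_fin term_ge0.
    - exact: measurable_funS (measurable_term k).
    - apply/measurable_EFinP; apply: measurable_funM => //.
      by apply: measurable_funS (measurable_powR _).
    move=> h; rewrite in_itv/= => /andP[h0 hb].
    rewrite -EFinM lee_fin.
    have -> : A * k%:R ^+ 2 * h `^ (1 - 2 * alpha) =
        4 * (k%:R * pi * h) ^+ 2 * (c0 `^ (- s) * h `^ (- s)).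
      have -> : 1 - 2 * alpha = 2%:R + - s by lra.
      rewrite powRD ?powR_mulrn ?(ltW h0)//; last by apply/implyP => _; rewrite lt0r_neq0.
      by rewrite /A; ring.
    apply: ler_pM; rewrite ?sob_weight_ge0 ?mulr_ge0 ?subr_ge0 ?cos_le1//.
      by rewrite ler_pM2l//; apply: one_sub_cos_le_sqr; rewrite !mulr_ge0 ?(ltW h0) ?(ltW p0).
    by apply: w_le => //; exact: le_trans b1.
  rewrite ge0_integralZl//=; last 3 first.
  - by apply/measurable_EFinP; apply: measurable_funS (measurable_powR _).
  - by move=> h _; rewrite lee_fin powR_ge0.
  - by rewrite lee_fin mulr_ge0 ?(ltW A0)// sqr_ge0.
  apply: (@le_trans _ _ ((A * k%:R ^+ 2)%:E *
      (b `^ (1 - 2 * alpha + 1) / (1 - 2 * alpha + 1))%:E)%E).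
    apply: lee_wpmul2l; first by rewrite lee_fin mulr_ge0 ?(ltW A0)// sqr_ge0.
    by apply: integral_powR_at0_le => //; lra.
  rewrite -EFinM lee_fin bpow.
  have -> : - (1 - 2 * alpha + 1) = 2 * alpha + - 2%:R by ring.
  rewrite powRD; last by apply/implyP => _; rewrite lt0r_neq0.
  rewrite powR_invn ?(ltW kR)// le_eqVlt; apply/orP; left; apply/eqP.
  by field; do ?[apply/andP; split]; apply: lt0r_neq0; lra.
apply: (@le_trans _ _ (\int[mu]_(h in `[b, 1%R]) (B%:E * (h `^ (- s))%:E))%E).
  apply: ge0_le_integral => //=.
  - by move=> h _; rewrite lee_fin term_ge0.
  - exact: measurable_funS (measurable_term k).
  - apply/measurable_EFinP; apply: measurable_funM => //.
    by apply: measurable_funS (measurable_powR _).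
  move=> h; rewrite in_itv/= => /andP[bh h1].
  rewrite -EFinM lee_fin /B -mulrA; apply: ler_pM; rewrite ?sob_weight_ge0 ?mulr_ge0 ?subr_ge0 ?cos_le1//.
    by have := cos_geN1 (k%:R * pi * h); lra.
  by apply: w_le => //; exact: lt_le_trans bh.
rewrite ge0_integralZl//=; last 3 first.
- by apply/measurable_EFinP; apply: measurable_funS (measurable_powR _).
- by move=> h _; rewrite lee_fin powR_ge0.
- by rewrite lee_fin ltW.
have sN : - s + 1 = - (2 * alpha) by ring.
rewrite integral_powR_itv//; last by rewrite sN oppr_eq0; apply/eqP => e; lra.
rewrite -EFinM lee_fin sN powR1 bpow opprK invrN mulrN -mulNr opprB.
have -> : B / (2 * alpha) * k%:R `^ (2 * alpha) = B * (k%:R `^ (2 * alpha) / (2 * alpha)) by ring.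
rewrite ler_pM2l// ler_wpM2r ?invr_ge0//; first lra.
by rewrite gerBl.
Qed.

Lemma sob_eig_lty k : (sob_eig s k < +oo :> \bar R)%E.
Proof.
case: k => [|k]; first by rewrite sob_eig0 ltry.
have [C _ /(_ k.+1 isT)] := sob_eig_le.
by move/le_lt_trans; apply; rewrite ltry.
Qed.

End sob_eig_bounds.

(** * Weighted l2 norms *)

Section weighted_l2.
Context {R : realType}.
Implicit Types (W U a b : nat -> R).

Definition sqsum W a : \bar R := (\sum_(0 <= k <oo) (W k * a k ^+ 2)%:E)%E.

(** An infinite sum is read as 0 by [fine], which is why the estimates below assume or return
    finiteness of [sqsum] along with a bound on [wnorm]. *)
Definition wnorm W a : R := Num.sqrt (fine (sqsum W a)).

Lemma wnorm_ge0 W a : 0 <= wnorm W a.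
Proof. exact: sqrtr_ge0. Qed.

Section fixed_weight.
Variable W : nat -> R.
Hypothesis W_gt0 : forall k, 0 < W k.

Let sqterm_ge0 a k : 0 <= W k * a k ^+ 2.
Proof. by rewrite mulr_ge0 ?sqr_ge0 ?(ltW (W_gt0 k)). Qed.

Lemma sqsum_ge0 a : (0 <= sqsum W a)%E.
Proof. by apply: nneseries_ge0 => k _ _; rewrite lee_fin. Qed.

Lemma sqsum_le a (B : R) : (forall n, \sum_(k < n) W k * a k ^+ 2 <= B) ->
  (sqsum W a <= B%:E)%E.
Proof.
move=> aB; apply: lime_le.
  by apply: is_cvg_nneseries => k _ _; rewrite lee_fin.
by apply: nearW => n; rewrite big_mkord sumEFin lee_fin.
Qed.

Lemma sqr_wnorm a : (sqsum W a < +oo)%E -> (wnorm W a ^+ 2)%:E = sqsum W a.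
Proof.
move=> afin; rewrite sqr_sqrtr ?fine_ge0 ?sqsum_ge0// fineK//.
by rewrite ge0_fin_numE// sqsum_ge0.
Qed.

Lemma partial_sum_le_wnorm a n : (sqsum W a < +oo)%E ->
  \sum_(k < n) W k * a k ^+ 2 <= wnorm W a ^+ 2.
Proof.
move=> afin; rewrite -lee_fin sqr_wnorm// -sumEFin.
rewrite -(big_mkord xpredT (fun k => (W k * a k ^+ 2)%:E)).
by apply: nneseries_lim_ge => k _ _; rewrite lee_fin.
Qed.

(** The device by which later estimates are reduced to finite sums. *)
Lemma wnorm_le a (B : R) : 0 <= B ->
  (forall n, \sum_(k < n) W k * a k ^+ 2 <= B ^+ 2) ->
  (sqsum W a < +oo)%E /\ wnorm W a <= B.
Proof.
move=> B0 /sqsum_le aB.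
have afin : (sqsum W a < +oo)%E by rewrite (le_lt_trans aB)// ltry.
split => //; move: aB; rewrite -sqr_wnorm// lee_fin ler_pXn2r//.
by rewrite nnegrE wnorm_ge0.
Qed.

Lemma term_le_wnorm a k : (sqsum W a < +oo)%E -> W k * a k ^+ 2 <= wnorm W a ^+ 2.
Proof.
move=> /(partial_sum_le_wnorm k.+1); apply: le_trans.
by rewrite big_ord_recr/= lerDr sumr_ge0.
Qed.

Lemma wnorm_eq0 a : (sqsum W a < +oo)%E -> wnorm W a = 0 -> forall k, a k = 0.
Proof.
move=> afin a0 k; have := term_le_wnorm k afin.
rewrite a0 expr0n/= pmulr_rle0// => ak0.
by apply/eqP; rewrite -sqrf_eq0 eq_le ak0 sqr_ge0.
Qed.

(* Minkowski, from [(x+y)^2 <= (1+t) x^2 + (1+1/t) y^2] with [t] the ratio of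
   the norms. *)
Lemma wnormD a b : (sqsum W a < +oo)%E -> (sqsum W b < +oo)%E ->
  (sqsum W (fun k => a k + b k)%R < +oo)%E /\
  wnorm W (fun k => a k + b k) <= wnorm W a + wnorm W b.
Proof.
move=> afin bfin; apply: wnorm_le => [|n]; first by rewrite addr_ge0 ?wnorm_ge0.
have := partial_sum_le_wnorm n afin; have := partial_sum_le_wnorm n bfin.
(* The ratio of the norms makes sense only if neither is 0; a sequence of norm 0 vanishes
   identically, and these cases are settled first. *)
have := wnorm_ge0 W a; rewrite le_eqVlt => /predU1P[/esym a0|].
  rewrite a0 add0r => pb _; rewrite (eq_bigr (fun k : 'I_n => W k * b k ^+ 2))//.
  by move=> k _; rewrite (wnorm_eq0 afin a0) add0r.
have := wnorm_ge0 W b; rewrite le_eqVlt => /predU1P[/esym b0|].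
  rewrite b0 addr0 => _ _ pa; rewrite (eq_bigr (fun k : 'I_n => W k * a k ^+ 2))//.
  by move=> k _; rewrite (wnorm_eq0 bfin b0) addr0.
set A := wnorm W a; set B := wnorm W b => B0 A0 pb pa.
apply: (@le_trans _ _ ((1 + B / A) * \sum_(k < n) W k * a k ^+ 2 +
    (1 + A / B) * \sum_(k < n) W k * b k ^+ 2)).
  rewrite !mulr_sumr -big_split; apply: ler_sum => k _ /=.
  rewrite [leRHS](_ : _ =
    W k * ((1 + B / A) * a k ^+ 2 + (1 + A / B) * b k ^+ 2)); last by ring.
  rewrite ler_wpM2l ?(ltW (W_gt0 k))//.
  rewrite -subr_ge0 [leRHS](_ : _ = (B * a k - A * b k) ^+ 2 / (A * B)); last first.
    by field; do ?[apply/andP; split]; apply: lt0r_neq0.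
  by rewrite divr_ge0 ?sqr_ge0// mulr_ge0 ?ltW.
have AB0 : 0 <= 1 + B / A by rewrite addr_ge0// divr_ge0 ?ltW.
have BA0 : 0 <= 1 + A / B by rewrite addr_ge0// divr_ge0 ?ltW.
apply: le_trans (lerD (ler_wpM2l AB0 pa) (ler_wpM2l BA0 pb)) _.
rewrite le_eqVlt; apply/orP; left; apply/eqP.
by field; do ?[apply/andP; split]; apply: lt0r_neq0.
Qed.

Lemma wnormZ (c : R) a : (sqsum W a < +oo)%E ->
  (sqsum W (fun k => c * a k)%R < +oo)%E /\
  wnorm W (fun k => c * a k) = `|c| * wnorm W a.
Proof.
move=> afin.
have E : sqsum W (fun k => c * a k) = ((c ^+ 2)%:E * sqsum W a)%E.
  rewrite /sqsum -nneseriesZl; last by move=> k _; rewrite lee_fin.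
  by apply: eq_eseriesr => k _; rewrite -EFinM exprMn mulrCA.
rewrite /wnorm E -(sqr_wnorm afin) -EFinM ltry; split => //=.
by rewrite sqrtrM ?sqr_ge0// !sqrtr_sqr (ger0_norm (wnorm_ge0 W a)).
Qed.

Lemma wnorm_tail a (e : R) : (sqsum W a < +oo)%E -> 0 < e -> exists n,
  (sqsum W (fun k => if (k < n)%N then 0 else a k)%R < +oo)%E /\
  wnorm W (fun k => if (k < n)%N then 0 else a k) <= e.
Proof.
move=> afin e0.
(* Otherwise every partial sum, and so the whole sum [wnorm W a ^+ 2], would be at most itself minus
   [e ^+ 2]. *)
have [n nE] : exists n, wnorm W a ^+ 2 - e ^+ 2 < \sum_(k < n) W k * a k ^+ 2.
  apply/not_existsP => no.
  have : (sqsum W a <= (wnorm W a ^+ 2 - e ^+ 2)%:E)%E.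
    by apply: sqsum_le => n; rewrite leNgt; apply/negP/no.
  rewrite -sqr_wnorm// lee_fin lerBrDr gerDl leNgt.
  by rewrite exprn_gt0.
exists n; apply: wnorm_le => [|m]; first exact: ltW.
apply: (@le_trans _ _ (wnorm W a ^+ 2 - \sum_(k < n) W k * a k ^+ 2)); last by lra.
rewrite lerBrDr.
apply: le_trans (partial_sum_le_wnorm (maxn m n) afin).
rewrite (big_ord_widen (maxn m n) (fun k => W k * a k ^+ 2) (leq_maxr m n)).
rewrite (big_ord_widen (maxn m n)
  (fun k => W k * (if (k < n)%N then 0 else a k) ^+ 2) (leq_maxl m n)).
rewrite big_mkcond [X in _ + X]big_mkcond -big_split; apply: ler_sum => k _ /=.
by case: (k < n)%N; case: (k < m)%N; rewrite ?expr0n ?mulr0 ?addr0 ?add0r.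
Qed.

End fixed_weight.

Lemma wnorm_le_scaled W U a (C : R) : (forall k, 0 < W k) -> (forall k, 0 < U k) ->
  0 <= C -> (forall k, W k <= C ^+ 2 * U k) -> (sqsum U a < +oo)%E ->
  (sqsum W a < +oo)%E /\ wnorm W a <= C * wnorm U a.
Proof.
move=> W0 U0 C0 WU afin; apply: wnorm_le => // [|n].
  by rewrite mulr_ge0 ?wnorm_ge0.
rewrite exprMn; apply: le_trans (ler_wpM2l (sqr_ge0 C) (partial_sum_le_wnorm U0 n afin)).
rewrite mulr_sumr; apply: ler_sum => k _.
by rewrite (mulrA (C ^+ 2)) ler_wpM2r ?sqr_ge0.
Qed.

End weighted_l2.

(** * Uniqueness of completions *)

(** Turns the bare functions supplied by choice into bundled linear maps. *)
Lemma linear_exists (R : pzRingType) (U V : lmodType R) (f : U -> V) :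
  linear f -> exists g : {linear U -> V}, g =1 f.
Proof.
move=> lf; pose m := GRing.isLinear.Build R U V *:%R f lf.
by exists (HB.pack_for {linear U -> V} f m).
Qed.

Section completion_graph.
Context {R : realType} {E : lmodType R} (N : E -> R).

(* Two completions are compared through the closure of [{(i0 p, i1 p)}]. *)
Definition completion_graph (V0 V1 : completeNormedModType R)
    (i0 : {linear E -> V0}) (i1 : {linear E -> V1}) (v : V0) (w : V1) : Prop :=
  forall e, 0 < e -> exists2 p, `|i0 p - v| < e & `|i1 p - w| < e.

Section two_completions.
Variables (V0 V1 : completeNormedModType R).
Variables (i0 : {linear E -> V0}) (i1 : {linear E -> V1}).
Hypotheses (c0 : is_completion N i0) (c1 : is_completion N i1).
Local Notation graph := (completion_graph i0 i1).

Lemma dense_range_approx (v : V0) (e : R) : 0 < e -> exists p, `|i0 p - v| < e.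
Proof.
move=> e0; have [_ /(_ (ball v e))] := c0.
case; [by exists v; exact: ballxx|exact: ball_open|].
by move=> _ [/[swap] [[p _ <-]]]; rewrite -ball_normE /= distrC => vp; exists p.
Qed.

(** If [i0 (p n)] tends to [v], then [i1 (p n)] is Cauchy, because both embeddings induce the same
    norm [N] on [E]; its limit is the required [w]. *)
Lemma completion_graph_total v : exists w, graph v w.
Proof.
have /choice[p pv] : forall n, exists p, `|i0 p - v| < n.+1%:R^-1.
  by move=> n; apply: dense_range_approx; rewrite invr_gt0.
have pv_near e : 0 < e -> \forall n \near \oo, `|i0 (p n) - v| < e.
  move=> e0; near=> n; apply: lt_trans (pv n) _.
  near: n; exact: near_infty_natSinv_lt (PosNum e0).
have : cvg (i1 (p n) @[n --> \oo]).
  apply: cauchy_cvg; apply: cauchy_exP => e e0.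
  have e20 : 0 < e / 2 by rewrite divr_gt0.
  have [n0 _ n0P] := pv_near _ e20.
  exists (i1 (p n0)).
  change (\forall n \near \oo, ball (i1 (p n0)) e (i1 (p n))); near=> n.
  rewrite -ball_normE/= -(linearB i1) (c1.1 _) -(c0.1 _) linearB.
  have -> : i0 (p n0) - i0 (p n) = (i0 (p n0) - v) - (i0 (p n) - v).
    by rewrite opprB addrA subrK.
  rewrite (le_lt_trans (ler_normB _ _))// [ltRHS](splitr e) ltrD//.
    by apply: n0P => /=.
  by near: n; exact: pv_near.
move=> /cvg_ex[w pw]; exists w => e e0.
have [n] : exists n, `|i0 (p n) - v| < e /\ `|w - i1 (p n)| < e.
  near \oo => n; exists n; split; first by near: n; exact: pv_near.
  by near: n; move/cvgrPdist_lt : pw => /(_ e e0).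
by move=> [? ?]; exists (p n) => //; rewrite distrC.
Unshelve. all: by end_near. Qed.

Lemma completion_graph_norm v w : graph v w -> `|v| = `|w|.
Proof.
move=> vw; apply/eqP/contraT => vNw.
have e0 : 0 < `| `|v| - `|w| | / 2 by rewrite divr_gt0// normr_gt0 subr_eq0.
have [p pv pw] := vw _ e0.
have : `| `|v| - `|w| | <= `|i0 p - v| + `|i1 p - w|.
  have -> : `|v| - `|w| = (`|v| - `|i0 p|) + (`|i1 p| - `|w|).
    by rewrite c0.1 c1.1 addrA subrK.
  apply: le_trans (ler_normD _ _) _; apply: lerD; last exact: ler_dist_dist.
  by rewrite distrC; exact: ler_dist_dist.
by move: pv pw; set x := `|_ - _|; lra.
Qed.

Lemma completion_graph_linear a v w v' w' : graph v w -> graph v' w' ->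
  graph (a *: v + v') (a *: w + w').
Proof.
move=> vw vw' e e0.
have a0 : 0 < `|a| + 1 by rewrite ltr_wpDl.
have d0 : 0 < e / (`|a| + 1) by rewrite divr_gt0.
have [p pv pw] := vw _ d0; have [p' pv' pw'] := vw' _ d0.
have bound (V : normedModType R) (x y x' y' : V) :
    `|x - y| < e / (`|a| + 1) -> `|x' - y'| < e / (`|a| + 1) ->
    `|a *: x + x' - (a *: y + y')| < e.
  move=> xy xy'.
  have -> : a *: x + x' - (a *: y + y') = a *: (x - y) + (x' - y').
    by rewrite scalerBr opprD addrACA.
  apply: le_lt_trans (ler_normD _ _) _; rewrite normrZ.
  have -> : e = `|a| * (e / (`|a| + 1)) + e / (`|a| + 1) by field; rewrite lt0r_neq0.
  by apply: ler_ltD => //; rewrite ler_wpM2l// ltW.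
by exists (a *: p + p'); rewrite linearP; exact: bound.
Qed.

(** By linearity [(0, w' - w)] lies in the graph, and graph pairs have equal norms. *)
Lemma completion_graph_functional v w w' : graph v w -> graph v w' -> w = w'.
Proof.
move=> vw vw'; have := completion_graph_norm (completion_graph_linear (-1) vw vw').
rewrite !scaleN1r addNr normr0 => /esym/normr0_eq0/eqP.
by rewrite addrC subr_eq0 => /eqP.
Qed.

Lemma completion_graph_embed p : graph (i0 p) (i1 p).
Proof. by move=> e e0; exists p; rewrite subrr normr0. Qed.

Lemma completion_graph_sym v w : graph v w -> completion_graph i1 i0 w v.
Proof. by move=> vw e /vw[p ? ?]; exists p. Qed.

End two_completions.

Lemma completion_unique (V0 V1 : completeNormedModType R)
    (i0 : {linear E -> V0}) (i1 : {linear E -> V1}) :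
  is_completion N i0 -> is_completion N i1 ->
  exists (J : {linear V0 -> V1}) (K : {linear V1 -> V0}),
    [/\ cancel J K, cancel K J, forall v, `|J v| = `|v| & forall p, J (i0 p) = i1 p].
Proof.
move=> c0 c1.
have /choice[J0 J0P] := completion_graph_total c0 c1.
have /choice[K0 K0P] := completion_graph_total c1 c0.
have [J JE] : exists J : {linear V0 -> V1}, J =1 J0.
  apply: linear_exists => a v v'.
  apply: completion_graph_functional c0 c1 _ _ _ (J0P _) _.
  exact: completion_graph_linear.
have [K KE] : exists K : {linear V1 -> V0}, K =1 K0.
  apply: linear_exists => a v v'.
  apply: completion_graph_functional c1 c0 _ _ _ (K0P _) _.
  exact: completion_graph_linear.
exists J, K; split.
- move=> v; rewrite KE JE.
  apply: completion_graph_functional c1 c0 _ _ _ (K0P _) _.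
  exact: completion_graph_sym.
- move=> v; rewrite JE KE.
  apply: completion_graph_functional c0 c1 _ _ _ (J0P _) _.
  exact: completion_graph_sym.
- by move=> v; rewrite JE -(completion_graph_norm c0 c1 (J0P v)).
- move=> p; rewrite JE.
  apply: completion_graph_functional c0 c1 _ _ _ (J0P _) _.
  exact: completion_graph_embed.
Qed.

End completion_graph.

(** * Completeness of the cosine system *)

Section cosine_polynomials.
Context {R : realType}.
Local Notation T := (measurableTypeR R).
Implicit Types (g : R -> R) (f : L2 R).

Lemma continuous_cos_span g : g \in @cos_span R -> continuous g.
Proof.
move=> /asboolP[n [a ga]] x.
have -> : g = (fun x => \sum_(k < n) a k * phi k x) by exact/funext.
by apply: continuous_lincomb => k; exact: continuous_phi.
Qed.

Lemma bounded_cos_span g : g \in @cos_span R -> exists M, forall x, `|g x| <= M.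
Proof.
move=> /asboolP[n [a ga]]; exists (\sum_(k < n) `|a k| * 2) => x.
rewrite ga (le_trans (ler_norm_sum _ _ _))//; apply: ler_sum => k _.
by rewrite normrM ler_wpM2l// phi_bound.
Qed.

Definition cosn (k : nat) : R -> R := fun x => cos (k%:R * pi * x).

Lemma phi_cosn k : (@phi R k.+1 : R -> R) = Num.sqrt 2 *: cosn k.+1.
Proof. by apply/funext. Qed.

Lemma phi_in_cos_span k : @phi R k \in @cos_span R.
Proof.
apply/asboolP; exists k.+1, (fun j => (j == k)%:R) => x.
rewrite (bigD1 ord_max)//= eqxx mul1r big1 ?addr0// => j jk.
rewrite (_ : (j == k :> nat) = false) ?mul0r//; apply: contraNF jk => /eqP jk.
exact/eqP/val_inj.
Qed.

Lemma cosn_in_cos_span k : cosn k \in @cos_span R.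
Proof.
case: k => [|k].
  rewrite (_ : cosn 0 = @phi R 0) ?phi_in_cos_span//.
  by apply/funext => x; rewrite /cosn mul0r mul0r cos0.
have -> : cosn k.+1 = (Num.sqrt 2)^-1 *: (@phi R k.+1 : R -> R).
  by rewrite phi_cosn scalerA mulVf ?scale1r// sqrtr_eq0 -ltNge.
by apply: rpredZ; exact: phi_in_cos_span.
Qed.

(** From [2 cos (k t) cos t = cos ((k + 1) t) + cos ((k - 1) t)]. This is the induction step that
    puts every polynomial in [cos (pi x)] into the span. *)
Lemma cos_span_mul_cosn g : g \in @cos_span R -> (fun x => g x * cosn 1 x) \in @cos_span R.
Proof.
have cosnM k : (fun x => cosn k x * cosn 1 x) \in @cos_span R.
  case: k => [|k].
    rewrite (_ : (fun x => _) = cosn 1) ?cosn_in_cos_span//.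
    by apply/funext => x; rewrite /cosn mul0r mul0r cos0 mul1r.
  have -> : (fun x => cosn k.+1 x * cosn 1 x) = 2^-1 *: (cosn k.+2 + cosn k).
    apply/funext => x; change (cosn k.+1 x * cosn 1 x = 2^-1 * (cosn k.+2 x + cosn k x)).
    rewrite /cosn.
    have -> : k.+2%:R * pi * x = k.+1%:R * pi * x + 1 * pi * x :> R.
      by rewrite -natr1; ring.
    have -> : k%:R * pi * x = k.+1%:R * pi * x - 1 * pi * x :> R.
      by rewrite -natr1; ring.
    by rewrite cosB cosD; field.
  by apply: rpredZ; apply: rpredD; exact: cosn_in_cos_span.
move=> /asboolP[n [a ga]].
have -> : (fun x => g x * cosn 1 x) =
    \sum_(k < n) a k *: ((fun x => @phi R k x * cosn 1 x) : R -> R).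
  apply/funext => x; rewrite fct_sumE ga mulr_suml; apply: eq_bigr => k _.
  by rewrite -mulrA.
apply: rpred_sum => k _; apply: rpredZ.
case: (nat_of_ord k) => [|j].
  rewrite (_ : (fun x => _) = cosn 1) ?cosn_in_cos_span//.
  by apply/funext => x; rewrite mul1r.
rewrite (_ : (fun x => _) = Num.sqrt 2 *: ((fun x => cosn j.+1 x * cosn 1 x) : R -> R)).
  exact: rpredZ.
by apply/funext => x; rewrite phi_cosn; exact/esym/mulrA.
Qed.

Lemma horner_cos_in_cos_span (p : {poly R}) :
  (fun x => p.[cos (pi * x)]) \in @cos_span R.
Proof.
elim/poly_ind: p => [|p c IH].
  rewrite (_ : (fun x => _) = 0) ?rpred0//.
  by apply/funext => x; rewrite horner0.
have -> : (fun x => (p * 'X + c%:P).[cos (pi * x)]) =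
    ((fun x => p.[cos (pi * x)] * cosn 1 x) : R -> R) + c *: (@phi R 0 : R -> R).
  apply/funext => x; rewrite hornerMXaddC /cosn mul1r.
  exact: (congr1 (+%R (p.[cos (pi * x)] * cos (pi * x))) (esym (mulr1 c))).
apply: rpredD; first exact: cos_span_mul_cosn.
by apply: rpredZ; exact: phi_in_cos_span.
Qed.

Lemma integrable_L2_mul f g (M : R) : measurable_fun [set: T] g ->
  (forall x, `|g x| <= M) ->
  (mu01 R).-integrable [set: T] (EFin \o (fun x => f x * g x)).
Proof.
move=> mg gM.
have fint : (mu01 R).-integrable [set: T] (EFin \o (f : R -> R)).
  apply/Lfun1_integrable/(Lfun_subset12 (@mu01_fin_num R)).
  exact: Lp_fun_Lfun.
have mf : measurable_fun [set: T] (f : R -> R).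
  by have /andP[/[!inE]/= mf _] := Lp_fun_Lfun f.
apply: (le_integrable _ _ _ (integrableZl _ M fint)) => //.
  by apply/measurable_EFinP; exact: measurable_funM.
move=> x _; rewrite /= lee_fin !normrM mulrC ler_wpM2r//.
exact: le_trans (gM x) (ler_norm _).
Qed.

Lemma integrable_L2 f : (mu01 R).-integrable [set: T] (EFin \o (f : R -> R)).
Proof.
apply/Lfun1_integrable/(Lfun_subset12 (@mu01_fin_num R)).
exact: Lp_fun_Lfun.
Qed.

Lemma orthogonal_cos_span f g : (forall k, cos_coef f k = 0) -> g \in @cos_span R ->
  \int[mu01 R]_x (f x * g x) = 0.
Proof.
move=> f0 /asboolP[n [a ga]].
under eq_Rintegral do rewrite ga mulrC.
rewrite Rintegral_lincomb.
  rewrite big1// => k _; under eq_Rintegral do rewrite mulrC.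
  by rewrite [\int[_]_(_ in _) _]f0 mulr0.
move=> k; under eq_fun do rewrite mulrC.
exact: integrable_cos_coef.
Qed.

End cosine_polynomials.

Section step_approximation.
Context {R : realType}.

Lemma bernoulli_ineq (v : R) (n : nat) : -1 <= v -> 1 + n%:R * v <= (1 + v) ^+ n.
Proof.
move=> v1; elim: n => [|n IH]; first by rewrite mul0r addr0 expr0.
have v0 : 0 <= 1 + v by lra.
rewrite exprS; apply: le_trans (ler_wpM2l v0 IH).
rewrite -subr_ge0 -natr1 [leRHS](_ : _ = n%:R * v ^+ 2); last by ring.
by rewrite mulr_ge0// sqr_ge0.
Qed.

(* The Brosowski--Deutsch polynomials, tending to the indicator of [u < 1/2]. *)
Definition step_poly (n : nat) (u : R) : R := (1 - u ^+ n) ^+ (2 ^ n).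

Lemma step_poly_itv n (u : R) : 0 <= u <= 1 -> 0 <= step_poly n u <= 1.
Proof.
move=> /andP[u0 u1]; rewrite /step_poly.
have un0 : 0 <= u ^+ n by rewrite exprn_ge0.
have un1 : u ^+ n <= 1 by rewrite exprn_ile1.
by rewrite exprn_ge0 ?exprn_ile1 ?subr_ge0// gerBl.
Qed.

(** Bernoulli bounds the polynomial below by [1 - 2^n u^n], and [2 u < 1]. *)
Lemma step_poly_cvg1 (u : R) : 0 <= u < 1 / 2 -> step_poly n u @[n --> \oo] --> (1 : R).
Proof.
move=> /andP[u0 u1].
have h : (2 * u) ^+ n @[n --> \oo] --> (0 : R).
  by apply: cvg_expr; rewrite ger0_norm; lra.
apply: (@squeeze_cvgr _ _ _ _ (fun n => 1 - (2 * u) ^+ n) (fun=> 1)).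
- apply: nearW => n.
  have u01 : 0 <= u <= 1 by apply/andP; split; lra.
  have /andP[_ ->] := step_poly_itv n u01; rewrite andbT.
  have un1 : u ^+ n <= 1 by rewrite exprn_ile1//; lra.
  have := @bernoulli_ineq (- u ^+ n) (2 ^ n); rewrite lerN2 => /(_ un1).
  by rewrite mulrN natrX -exprMn.
- by rewrite -[X in _ --> X]subr0; apply: cvgB => //; exact: cvg_cst.
- exact: cvg_cst.
Qed.

(** The product of the polynomial with [(1 + u^n)^(2^n)] is [(1 - u^(2 n))^(2^n) <= 1], and by
    Bernoulli that factor is at least [(2 u)^n], which grows geometrically. *)
Lemma step_poly_cvg0 (u : R) : 1 / 2 < u <= 1 -> step_poly n u @[n --> \oo] --> (0 : R).
Proof.
move=> /andP[u1 u2].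
have h : ((2 * u)^-1) ^+ n @[n --> \oo] --> (0 : R).
  apply: cvg_expr; rewrite ger0_norm ?invr_ge0; last by lra.
  by rewrite invf_lt1; lra.
apply: (@squeeze_cvgr _ _ _ _ (fun=> 0) (fun n => ((2 * u)^-1) ^+ n)) => //; last exact: cvg_cst.
apply: nearW => n.
have u01 : 0 <= u <= 1 by apply/andP; split; lra.
have /andP[-> _] /= := step_poly_itv n u01.
have un0 : 0 <= u ^+ n by rewrite exprn_ge0//; lra.
have un1 : u ^+ n <= 1 by rewrite exprn_ile1//; lra.
have q0 : 0 < (2 * u) ^+ n by rewrite exprn_gt0//; lra.
rewrite exprVn -[leRHS]mul1r ler_pdivlMr//.
apply: (@le_trans _ _ (step_poly n u * (1 + u ^+ n) ^+ (2 ^ n))).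
  rewrite ler_wpM2l//; first by have /andP[] := step_poly_itv n u01.
  have := @bernoulli_ineq (u ^+ n) (2 ^ n); rewrite natrX -exprMn => /(_ _)/(le_trans _); apply; lra.
rewrite /step_poly -exprMn exprn_ile1//.
  by rewrite mulr_ge0; lra.
have -> : (1 - u ^+ n) * (1 + u ^+ n) = 1 - (u ^+ n) ^+ 2 by ring.
by rewrite gerBl sqr_ge0.
Qed.

End step_approximation.

Section cosine_completeness.
Context {R : realType}.
Local Notation mu := (@lebesgue_measure R).
Local Notation T := (measurableTypeR R).

Lemma ae_lebesgue_mu01 (P : R -> Prop) :
  (\forall x \ae mu, P x) -> \forall x \ae mu01 R, P x.
Proof.
move=> [N [mN N0 PN]]; exists N; split => //.
apply/eqP; rewrite eq_le measure_ge0 andbT -N0.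
by rewrite /mu01 /= /mrestr; apply: measureIl => //; exact: measurable_itv.
Qed.

Lemma ae_mu01_neq (a : R) : \forall x \ae mu01 R, x != a.
Proof.
apply: ae_lebesgue_mu01; exists [set a]; split => //.
  exact: lebesgue_measure_set1.
by move=> x /= /negP; rewrite negbK => /eqP.
Qed.

Global Instance ae_mu01_filter : Filter (nbhs (almost_everywhere (mu01 R))).
Proof. exact: (ae_filter_ringOfSetsType (mu01 R)). Qed.

Lemma ae_mu01_oo : \forall x \ae mu01 R, 0 < x < 1.
Proof.
have h : \forall x \ae mu01 R, 0 <= x <= 1 by exact: ae_mu01.
apply: filterS3 h (ae_mu01_neq 0) (ae_mu01_neq 1) => x /andP[x0 x1] n0 n1.
by rewrite !lt_neqAle x0 x1 eq_sym n0 n1.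
Qed.

(** Step polynomials composed with [u] are cosine polynomials with values in [[0, 1]] that tend to
    the indicator except at [a]; dominated convergence, with bound [|f|], carries the orthogonality
    over. *)
Lemma orthogonal_step (f : L2 R) (a : R) : 0 < a < 1 ->
  (forall k, cos_coef f k = 0) -> \int[mu01 R]_x (f x * (x <= a)%R%:R) = 0.
Proof.
move=> /andP[a0 a1] f0.
have p0 := pi_gt0 R.
(* Affine in [cos (pi x)], with values in [[0, 1]], and equal to 1/2 at [x = a]; since the cosine
   decreases on [[0, pi]], [u x < 1/2] exactly for [x < a] within [[0, 1]]. *)
pose u (x : R) : R := (2 - (cos (pi * x) - cos (pi * a))) / 4.
have u01 x : 0 <= u x <= 1.
  have := cos_geN1 (pi * x); have := cos_le1 (pi * x).
  have := cos_geN1 (pi * a); have := cos_le1 (pi * a).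
  by rewrite /u => *; apply/andP; split; lra.
have piI (x : R) : 0 <= x <= 1 -> pi * x \in `[0, pi].
  by move=> /andP[x0 x1]; rewrite in_itv/= mulr_ge0 ?(ltW p0)//= ler_piMr// ltW.
have aI : pi * a \in `[0, pi] by apply: piI; rewrite !ltW.
have spanP n : (fun x => step_poly n (u x)) \in @cos_span R.
  pose P : {poly R} :=
    (1 - (((2 + cos (pi * a)) / 4)%:P - (1 / 4)%:P * 'X) ^+ n) ^+ (2 ^ n).
  rewrite (_ : (fun x => _) = (fun x => P.[cos (pi * x)])).
    exact: horner_cos_in_cos_span.
  apply/funext => x; rewrite /P /step_poly !(hornerE, horner_exp).
  by congr ((1 - _ ^+ _) ^+ _); rewrite /u; field.
have mstep n : measurable_fun [set: T] (fun x : T => step_poly n (u x)).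
  by apply: continuous_measurable_fun; exact: (continuous_cos_span (spanP n)).
have mind : measurable_fun [set: T] (fun x : T => (x <= a)%R%:R : R).
  rewrite (_ : (fun x => _) = \1_`]-oo, a] :> (R -> R)); first exact: measurable_indic.
  by apply/funext => x; rewrite indicE mem_setE in_itv/=.
have mf : measurable_fun [set: T] (f : R -> R).
  by have /andP[/[!inE]/= ? _] := Lp_fun_Lfun f.
have istep n : (mu01 R).-integrable [set: T] (EFin \o (fun x => f x * step_poly n (u x))).
  apply: (@integrable_L2_mul _ _ _ 1) => // x.
  by have /andP[s0 s1] := step_poly_itv n (u01 x); rewrite ger0_norm.
have int0 n : (\int[mu01 R]_x (f x * step_poly n (u x))%:E = 0)%E.
  have := orthogonal_cos_span f0 (spanP n); rewrite /Rintegral => int0.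
  by rewrite -[LHS]fineK ?int0//; exact: integrable_fin_num (istep n).
have [] := @dominated_convergence _ _ _ (mu01 R) [set: T] measurableT
  (fun n x => (f x * step_poly n (u x))%:E) (fun x => (f x * (x <= a)%R%:R)%:E)
  (fun x => `|(f x)%:E|%E).
- by move=> n; apply/measurable_EFinP; exact: measurable_funM.
- by apply/measurable_EFinP; exact: measurable_funM.
- have h : \forall x \ae mu01 R, 0 <= x <= 1 by exact: ae_mu01.
  apply: filterS2 h (ae_mu01_neq a) => x x01 xa _.
  apply: cvg_EFin; first exact: nearW.
  apply: cvgM; first exact: cvg_cst.
  have [xa'|xa'] := leP x a.
    apply: step_poly_cvg1; have /andP[-> _] := u01 x.
    have : cos (pi * a) < cos (pi * x).
      by rewrite (ltr_cos (piI x x01) aI) ltr_pM2l// lt_neqAle xa xa'.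
    by rewrite /u => ?; lra.
  apply: step_poly_cvg0; have /andP[_ ->] := u01 x; rewrite andbT.
  have : cos (pi * x) < cos (pi * a) by rewrite (ltr_cos aI (piI x x01)) ltr_pM2l.
  by rewrite /u => ?; lra.
- by apply: integrable_abse; exact: integrable_L2.
- apply: nearW => x n _; rewrite /= lee_fin normrM ler_piMr//.
  by have /andP[s0 s1] := step_poly_itv n (u01 x); rewrite ger0_norm.
move=> _ _ cv.
have ev : (\int[mu01 R]_x (f x * (x <= a)%R%:R)%:E = 0)%E.
  apply: (cvg_unique _ cv) => //.
  rewrite (_ : [sequence _]_n = cst 0%E); first exact: cvg_cst.
  by apply/funext => n; exact: int0.
by rewrite /Rintegral ev.
Qed.

(** The primitive of [f] vanishes on []0, 1[] by [orthogonal_step], and by Lebesgue differentiation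
    its derivative is [f] almost everywhere. *)
Lemma cos_coef_eq0 (f : L2 R) : (forall k, cos_coef f k = 0) -> f = 0.
Proof.
move=> f0.
have mf : measurable_fun [set: T] (f : R -> R).
  by have /andP[/[!inE]/= ? _] := Lp_fun_Lfun f.
(* Representatives are arbitrary outside [[0, 1]]; the cut-off makes the function integrable on the
   whole line, as a primitive starting at minus infinity requires. *)
pose g : R -> R := (f : R -> R) \_ `[0, 1].
have mI : measurable (`[0, 1] : set T) by exact: measurable_itv.
have fI : mu.-integrable `[0, 1] (EFin \o (f : R -> R)).
  have /integrableP[_ ifin] := integrable_L2 f.
  apply/integrableP; split; first by apply/measurable_EFinP; exact: measurable_funS mf.
  rewrite -integral_mu01//; apply: measurableT_comp => //; exact/measurable_EFinP.
have gloc : locally_integrable [set: R] g by exact: integrable_locally_restrict.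
have gint : mu.-integrable [set: T] (EFin \o g).
  rewrite (_ : EFin \o g = (EFin \o (f : R -> R)) \_ `[0, 1]).
    by apply/(integrable_mkcond _ mI).
  by apply/funext => x; rewrite /g /= !patchE; case: ifP.
have giy y : mu.-integrable `]-oo, y] (EFin \o g).
  by apply: integrableS gint => //; exact: measurable_itv.
have Fder := FTC1Ny giy gloc.
pose F x := \int[mu]_(t in `]-oo, x]) g t.
have F0 x : 0 < x < 1 -> F x = 0.
  move=> x01; rewrite -(orthogonal_step x01 f0) /F Rintegral_mkcond.
  rewrite [RHS]/Rintegral integral_mu01; last first.
    apply/measurable_EFinP; apply: measurable_funM => //.
    rewrite (_ : (fun x => _) = \1_`]-oo, x] :> (R -> R)); first exact: measurable_indic.
    by apply/funext => t; rewrite indicE mem_setE in_itv/=.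
  rewrite integral_mkcond; congr fine; apply: eq_integral => t _.
  rewrite /g !patchE !mem_setE !in_itv/=.
  by case: (t <= x); case: (0 <= t <= 1); rewrite ?mulr1 ?mulr0.
have fae : \forall x \ae mu01 R, f x = 0.
  apply: filterS2 ae_mu01_oo (ae_lebesgue_mu01 Fder) => x x01 [_].
  have F'0 : F^`()%classic x = 0.
    rewrite derive1E (@near_eq_derive _ _ _ _ (cst 0)) ?derive_cst//.
    have xI : x \in `]0, 1[ by rewrite in_itv.
    have := near_in_itvoo xI; apply: filterS => y; rewrite in_itv/=; exact: F0.
  move=> F'g; have {F'g} : F^`()%classic x = g x by exact: F'g.
  rewrite F'0 /g patchE mem_setE in_itv/=; case/andP: x01 => x0 x1.
  by rewrite (ltW x0) (ltW x1).
apply: Lp_fun_ae_inj; apply: filterS2 fae (Lp_fun0 (mu01 R) (lee1_2 R)) => x -> ->; exact: erefl.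
Qed.

Lemma cos_coef_inj (f g : L2 R) : (forall k, cos_coef f k = cos_coef g k) -> f = g.
Proof.
move=> fg; apply/eqP; rewrite -subr_eq0; apply/eqP/cos_coef_eq0 => k.
have := cos_coefP (-1) g f k; rewrite scaleN1r addrC => ->.
by rewrite fg mulN1r addNr.
Qed.

End cosine_completeness.

(** * Functions with prescribed, absolutely summable cosine coefficients *)

Section cosine_synthesis.
Context {R : realType}.
Local Notation T := (measurableTypeR R).

Lemma bounded_L2 (g : R -> R) (M : R) : measurable_fun [set: T] g ->
  (forall x, `|g x| <= M) -> exists f : L2 R, \forall x \ae mu01 R, f x = g x.
Proof.
move=> mg gM.
have g2 : g \in Lfun (mu01 R) 2%:E.
  rewrite inE; apply/andP; split; rewrite inE//=.
  rewrite /finite_norm unlock poweR_lty//.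
  have M0 : 0 <= M := le_trans (normr_ge0 _) (gM 0).
  apply: (@le_lt_trans _ _ (\int[mu01 R]_x (cst (M ^+ 2)%:E) x)%E); last first.
    by rewrite integral_cst// mu01_setT mule1 ltry.
  apply: ge0_le_integral => //.
  - by move=> x _; rewrite poweR_ge0.
  - rewrite (_ : (fun _ => _) = (fun x => (`|g x| `^ 2)%:E))//.
    apply/measurable_EFinP; apply: (measurableT_comp (measurable_powR 2)).
    exact: measurableT_comp.
  by move=> x _; rewrite /= lee_fin powR_mulrn// ler_pXn2r ?nnegrE.
by exists (\pi_(L2 R) (Lfun_Sub (lee1_2 R) g2))%qT; exact: Lp_repr_ae.
Qed.

Lemma cos_coef_ae (f : L2 R) (g : R -> R) k : measurable_fun [set: T] g ->
  (\forall x \ae mu01 R, f x = g x) -> cos_coef f k = \int[mu01 R]_x (g x * phi k x).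
Proof.
move=> mg fg; rewrite /cos_coef /Rintegral; congr fine; apply: ae_eq_integral => //.
- exact: measurable_int (integrable_cos_coef f k).
- by apply/measurable_EFinP; apply: measurable_funM => //; exact: measurable_phi.
- by apply: filterS fg => x -> _.
Qed.

Lemma cos_coef_lincomb (f : L2 R) (a : nat -> R) n k :
  (\forall x \ae mu01 R, f x = \sum_(j < n) a j * phi j x) ->
  cos_coef f k = if (k < n)%N then a k else 0.
Proof.
move=> fa; rewrite (cos_coef_ae _ _ fa); last first.
  by apply: continuous_measurable_fun; apply: continuous_lincomb => j; exact: continuous_phi.
rewrite Rintegral_lincomb; last first.
  move=> j; apply: continuous_integrable_mu01 => x.
  by apply: cvgM; exact: continuous_phi.
case: ltnP => kn.
  rewrite (bigD1 (Ordinal kn))//= phi_orthonormal eqxx mulr1 big1 ?addr0// => j jk.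
  rewrite phi_orthonormal (_ : (j == k :> nat) = false) ?mulr0n ?mulr0//.
  by apply: contraNF jk => /eqP jk; exact/eqP/val_inj.
rewrite big1// => j _; rewrite phi_orthonormal (_ : (j == k :> nat) = false) ?mulr0n ?mulr0//.
by apply/eqP => jk; move: (ltn_ord j); rewrite jk ltnNge kn.
Qed.

(** The series converges absolutely at every point and its partial sums are bounded by [2 M]. By
    dominated convergence the [k]-th coefficient of the limit is the limit of those of the partial
    sums, which equal [a k] as soon as [n > k]. *)
Lemma cos_synthesis (a : nat -> R) (M : R) :
  (forall n, \sum_(k < n) `|a k| <= M) ->
  exists f : L2 R, forall k, cos_coef f k = a k.
Proof.
move=> aM.
have M0 : 0 <= M by have := aM 0%N; rewrite big_ord0.
pose S (n : nat) (x : R) : R := \sum_(k < n) a k * phi k x.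
have cS n : continuous (S n) by apply: continuous_lincomb => k; exact: continuous_phi.
have mS n : measurable_fun [set: T] (S n) by exact: continuous_measurable_fun.
have normS n x : \sum_(k < n) `|a k * phi k x| <= 2 * M.
  apply: (@le_trans _ _ (2 * \sum_(k < n) `|a k|)); last by rewrite ler_wpM2l.
  rewrite mulr_sumr; apply: ler_sum => k _.
  by rewrite normrM mulrC ler_wpM2r// phi_bound.
have bS n x : `|S n x| <= 2 * M by apply: le_trans (normS n x); exact: ler_norm_sum.
have cvgS x : cvgn (fun n => S n x).
  have -> : (fun n => S n x) = series (fun k => a k * phi k x).
    by apply/funext => n; rewrite /S /series /= big_mkord.
  apply: normed_cvg; apply: nondecreasing_is_cvgn.
    by apply/nondecreasing_series => n _ _; exact: normr_ge0.
  exists (2 * M) => _ [n _ <-]; have := normS n x.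
  by rewrite -(big_mkord xpredT (fun k => `|a k * phi k x|)).
pose g x := limn (fun n => S n x).
have Sg x : S n x @[n --> \oo] --> g x by exact: cvgS.
have mg : measurable_fun [set: T] g by apply: (measurable_fun_cvg mS) => x _; exact: Sg.
have bg x : `|g x| <= 2 * M.
  have cn : `|S n x| @[n --> \oo] --> `|g x| by apply: cvg_norm; exact: Sg.
  rewrite -(cvg_lim _ cn)//; apply: limr_le; first exact: cvgP cn.
  exact: nearW.
have [f fg] := bounded_L2 mg bg.
exists f => k; rewrite (cos_coef_ae _ mg fg).
have bphi n x : `|S n x * phi k x| <= 4 * M.
  rewrite normrM (_ : 4 * M = 2 * M * 2); last by ring.
  by apply: ler_pM => //; exact: phi_bound.
have mphi := @measurable_phi R k.
have [] := @dominated_convergence _ _ _ (mu01 R) [set: T] measurableT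
  (fun n x => (S n x * phi k x)%:E) (fun x => (g x * phi k x)%:E) (cst (4 * M)%:E).
- by move=> n; apply/measurable_EFinP; exact: measurable_funM.
- by apply/measurable_EFinP; exact: measurable_funM.
- apply: nearW => x _; apply: cvg_EFin; first exact: nearW.
  by apply: cvgM; [exact: Sg|exact: cvg_cst].
- apply: (@bounded_integrable_mu01 _ (cst (4 * M)) (4 * M)) => // x.
  by rewrite ger0_norm// mulr_ge0.
- by apply: nearW => x n _; rewrite /= lee_fin.
move=> _ _ cv.
have intS n : (k < n)%N -> (\int[mu01 R]_x (S n x * phi k x)%:E = (a k)%:E)%E.
  move=> kn.
  have iS : (mu01 R).-integrable [set: T] (EFin \o (fun x => S n x * phi k x)).
    apply: continuous_integrable_mu01 => x.
    by apply: cvgM; [exact: cS|exact: continuous_phi].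
  rewrite -[LHS]fineK; last exact: integrable_fin_num iS.
  congr EFin; rewrite -[LHS]/(\int[mu01 R]_x (S n x * phi k x)).
  have [h hS] := bounded_L2 (mS n) (bS n).
  by rewrite -(cos_coef_ae k (mS n) hS) (cos_coef_lincomb k hS) kn.
have ev : (\int[mu01 R]_x (g x * phi k x)%:E = (a k)%:E)%E.
  apply/esym; apply: (cvg_unique _ _ cv) => //.
  apply: cvg_near_cst; exists k.+1 => // n /= kn; exact: intS.
by rewrite /Rintegral ev.
Qed.

End cosine_synthesis.

(** * The cosine space in terms of coefficients *)

Section p_series.
Context {R : realType}.

(** The mean value theorem for [x^(1 - s)] bounds each term after the first by a telescoping
    difference divided by [s - 1]. *)
Lemma p_series_bounded (s : R) : 1 < s ->
  exists M, forall n, \sum_(k < n) (k.+1%:R `^ (- s)) <= M.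
Proof.
move=> s1; have s10 : 0 < s - 1 by lra.
have step k : (s - 1) * k.+2%:R `^ (- s) <= k.+1%:R `^ (1 - s) - k.+2%:R `^ (1 - s).
  have k0 : 0 < k.+1%:R :> R by rewrite ltr0n.
  have kk : k.+1%:R < k.+2%:R :> R by rewrite ltr_nat.
  have dp (x : R) : x \in `]k.+1%:R, k.+2%:R[ ->
      is_derive x 1 (@powR R ^~ (1 - s)) ((1 - s) * x `^ (1 - s - 1)).
    by rewrite in_itv/= => /andP[kx _]; apply: is_derive1_powR; exact: lt_trans kx.
  have cp : {within `[k.+1%:R, k.+2%:R], continuous (@powR R ^~ (1 - s))}.
    apply: derivable_within_continuous => x; rewrite in_itv/= => /andP[kx _].
    by have := @is_derive1_powR R (1 - s) x (lt_le_trans k0 kx) => ?; exact: ex_derive.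
  have [c] := MVT kk dp cp; rewrite in_itv/= => /andP[kc ck].
  have -> : 1 - s - 1 = - s by ring.
  have -> : k.+2%:R - k.+1%:R = 1 :> R by rewrite -(natr1 k.+1); ring.
  rewrite mulr1 -[X in _ <= X]opprB => ->; rewrite -mulNr opprB ler_pM2l//.
  have c0 : 0 < c := lt_trans k0 kc.
  rewrite !powRN lef_pV2 ?posrE ?powR_gt0 ?ltr0n//.
  by apply: ge0_ler_powR; rewrite ?nnegrE ?(ltW c0) ?(ltW ck)//; lra.
exists (1 + (s - 1)^-1) => n.
case: n => [|n]; first by rewrite big_ord0 addr_ge0// invr_ge0 ltW.
rewrite big_ord_recl powR1 lerD2l.
suff : (s - 1) * \sum_(k < n) k.+2%:R `^ (- s) <= 1 - n.+1%:R `^ (1 - s).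
  move=> h; rewrite -[leRHS]mulr1 ler_pdivlMl//.
  by apply: (le_trans h); rewrite gerBl powR_ge0.
elim: n => [|n IH]; first by rewrite big_ord0 mulr0 powR1 subrr.
rewrite big_ord_recr/= mulrDr; apply: (le_trans (lerD IH (step n))).
by rewrite addrA subrK.
Qed.

End p_series.

Section cosine_weights.
Context {R : realType} (alpha gamma : R).
Hypotheses (halpha : 1 / 2 < alpha < 1) (gamma_gt0 : 0 < gamma).
Local Notation T := (measurableTypeR R).

Definition cosw (k : nat) : R :=
  if k == 0%N then 1 else gamma ^- 2 * k%:R `^ (2 * alpha).

Lemma cosw_gt0 k : 0 < cosw k.
Proof.
case: k => [|k] //=; rewrite /cosw mulr_gt0 ?invr_gt0 ?exprn_gt0// powR_gt0.
Qed.

Lemma cos_sqnormE (f : L2 R) : cos_sqnorm alpha gamma f = sqsum cosw (cos_coef f).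
Proof.
have t0 (h : R) k : (0 <= (k%:R `^ (2 * alpha) * h ^+ 2)%:E)%E.
  by rewrite lee_fin mulr_ge0 ?powR_ge0 ?sqr_ge0.
rewrite /sqsum nneseries_recl//; last first.
  by move=> k _; rewrite lee_fin mulr_ge0 ?sqr_ge0 ?(ltW (cosw_gt0 k)).
rewrite /cos_sqnorm; congr (_ + _)%E; first by rewrite mul1r.
rewrite -nneseriesZl// eseries_cond [RHS]eseries_cond.
apply: eq_eseriesr => -[|k] // _.
by rewrite -EFinM mulrA.
Qed.

Lemma finite_Hcos (f : Hcos alpha gamma) : (sqsum cosw (cos_coef f) < +oo)%E.
Proof. by rewrite -cos_sqnormE; exact: (Hcos_finite f). Qed.

Lemma Hcos_normE (f : Hcos alpha gamma) : Hcos_norm f = wnorm cosw (cos_coef f).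
Proof. by rewrite /Hcos_norm cos_sqnormE. Qed.

Lemma Hcos_coefP a (f g : Hcos alpha gamma) k :
  cos_coef (a *: f + g) k = a * cos_coef f k + cos_coef g k.
Proof. exact: cos_coefP. Qed.

Lemma Hcos_coefB (f g : Hcos alpha gamma) k :
  cos_coef (f - g) k = cos_coef f k - cos_coef g k.
Proof.
by have := Hcos_coefP (-1) g f k; rewrite scaleN1r addrC => ->; rewrite mulN1r addrC.
Qed.

Lemma Hcos_coef_inj (f g : Hcos alpha gamma) :
  (forall k, cos_coef f k = cos_coef g k) -> f = g.
Proof. by move=> /cos_coef_inj fg; exact: val_inj. Qed.

(** Finite weighted norm implies absolute summability: [2 |a k| <= cosw k * a k ^+ 2 + 1 / cosw k],
    and the reciprocal weights are summable because [2 alpha > 1]. *)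
Lemma Hcos_synthesis (a : nat -> R) : (sqsum cosw a < +oo)%E ->
  exists f : Hcos alpha gamma, forall k, cos_coef f k = a k.
Proof.
move=> afin; have /andP[a1 a2] := halpha.
have [M0 M0P] := @p_series_bounded R (2 * alpha) ltac:(lra).
have wV n : \sum_(k < n) (cosw k)^-1 <= 1 + gamma ^+ 2 * M0.
  have M00 : 0 <= M0 by have := M0P 0%N; rewrite big_ord0.
  case: n => [|n]; first by rewrite big_ord0 addr_ge0// mulr_ge0// sqr_ge0.
  rewrite big_ord_recl /cosw/= invr1 lerD2l.
  apply: le_trans (ler_wpM2l (sqr_ge0 gamma) (M0P n)).
  rewrite mulr_sumr; apply: ler_sum => k _.
  by rewrite invfM invrK powRN.
have aM n : \sum_(k < n) `|a k| <= wnorm cosw a ^+ 2 + (1 + gamma ^+ 2 * M0).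
  apply: le_trans (lerD (partial_sum_le_wnorm cosw_gt0 n afin) (wV n)).
  rewrite -big_split; apply: ler_sum => k _ /=.
  have w0 := cosw_gt0 k; have aE : a k ^+ 2 = `|a k| ^+ 2 by rewrite real_normK ?num_real.
  have -> : cosw k * a k ^+ 2 + (cosw k)^-1 =
      (cosw k * `|a k| - 1) ^+ 2 / cosw k + 2 * `|a k|.
    by rewrite aE; field; rewrite lt0r_neq0.
  have : 0 <= (cosw k * `|a k| - 1) ^+ 2 / cosw k by rewrite divr_ge0 ?sqr_ge0 ?ltW.
  by have := normr_ge0 (a k); lra.
have [f fa] := cos_synthesis aM.
have ffin : (f : L2 R) \in @finite_cos_norm R alpha gamma.
  rewrite unfold_in cos_sqnormE (_ : cos_coef f = a)//.
  exact/funext.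
by exists (MkHcos ffin).
Qed.

Lemma Hcos_of_Pcos (p : Pcos R) : exists f : Hcos alpha gamma, \forall x \ae mu01 R, f x = p x.
Proof.
have [M pM] := bounded_cos_span (Pcos_span p).
have mp : measurable_fun [set: T] (p : R -> R).
  by apply: continuous_measurable_fun; exact: continuous_cos_span (Pcos_span p).
have [f fp] := bounded_L2 mp pM.
have /asboolP[n [a pa]] := Pcos_span p.
have ffin : (f : L2 R) \in @finite_cos_norm R alpha gamma.
  rewrite unfold_in cos_sqnormE.
  apply: le_lt_trans (ltry (\sum_(k < n) cosw k * cos_coef f k ^+ 2)).
  apply: sqsum_le => [|m]; first exact: cosw_gt0.
  have cf k : cos_coef f k = if (k < n)%N then a k else 0.
    by apply: cos_coef_lincomb; apply: filterS fp => x ->; exact: pa.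
  (* Both sums are extended to the common range [maxn m n]; the coefficients from [n] on are 0. *)
  rewrite (big_ord_widen (maxn m n) (fun k => cosw k * cos_coef f k ^+ 2) (leq_maxr m n)).
  rewrite (big_ord_widen (maxn m n) (fun k => cosw k * cos_coef f k ^+ 2) (leq_maxl m n)).
  rewrite big_mkcond [leRHS]big_mkcond; apply: ler_sum => k _.
  have w0 := ltW (cosw_gt0 k).
  rewrite cf; case: (k < n)%N; case: (k < m)%N; rewrite ?expr0n ?mulr0//.
  by rewrite mulr_ge0 ?sqr_ge0.
by exists (MkHcos ffin).
Qed.

Lemma Hcos_ae_inj (f g : Hcos alpha gamma) (p : R -> R) :
  (\forall x \ae mu01 R, f x = p x) -> (\forall x \ae mu01 R, g x = p x) -> f = g.
Proof.
move=> fp gp; apply: val_inj; apply: Lp_fun_ae_inj.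
by apply: filterS2 fp gp => x; rewrite /= => -> ->.
Qed.

(** The truncated cosine expansion of [f] serves. The weight is arbitrary because two instances are
    needed: Sobolev weights for density in the completion, cosine weights for uniqueness of the
    extension. *)
Lemma Hcos_approx (W : nat -> R) (f : Hcos alpha gamma) (e : R) :
  (forall k, 0 < W k) -> (sqsum W (cos_coef f) < +oo)%E -> 0 < e ->
  exists p : Pcos R, forall g : Hcos alpha gamma,
    (\forall x \ae mu01 R, g x = p x) -> wnorm W (cos_coef (f - g)) <= e.
Proof.
move=> W0 ffin e0; have [n [_ nP]] := wnorm_tail W0 ffin e0.
have sp : (fun x => \sum_(k < n) cos_coef f k * phi k x) \in @cos_span R.
  by apply/asboolP; exists n, (cos_coef f).
exists (MkPcos sp) => g gp.
rewrite (_ : cos_coef (f - g) = (fun k => if (k < n)%N then 0 else cos_coef f k))//.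
apply/funext => k; rewrite Hcos_coefB (cos_coef_lincomb k gp).
by case: ifP => _; rewrite ?subrr ?subr0.
Qed.

End cosine_weights.

(** * The Sobolev completion *)

Section sobolev_norm.
Context {R : realType} (alpha : R).
Hypothesis halpha : 1 / 2 < alpha < 1.
Local Notation T := (measurableTypeR R).
Local Notation s := (2 * alpha + 1).

Definition sob_const : R := (1 - alpha) * pi ^+ 3 / 8.

Lemma sob_const_gt0 : 0 < sob_const.
Proof.
have /andP[_ a1] := halpha.
by rewrite divr_gt0// mulr_gt0 ?subr_gt0// exprn_gt0// pi_gt0.
Qed.

(** The diagonal entries of [sob_inner] in the basis [phi]. The form vanishes on constants, so the
    entry at 0 comes from the product of the means alone. *)
Definition sobw (gamma : R) (k : nat) : R :=
  if k == 0%N then 1 else gamma ^- 2 * (sob_const * fine (sob_eig s k)).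

Lemma fine_sob_eig_bounds : exists c C : R, [/\ 0 < c, 0 < C &
  forall k, (0 < k)%N ->
    c * k%:R `^ (2 * alpha) <= fine (sob_eig s k) <= C * k%:R `^ (2 * alpha)].
Proof.
have [c c0 cP] := sob_eig_ge halpha; have [C C0 CP] := sob_eig_le halpha.
exists c, C; split => // k k0.
have fk : sob_eig s k \is a fin_num.
  by rewrite ge0_fin_numE ?sob_eig_ge0// sob_eig_lty.
by rewrite -!lee_fin fineK// cP// CP.
Qed.

Lemma sobw_gt0 gamma k : 0 < gamma -> 0 < sobw gamma k.
Proof.
move=> g0; case: k => [|k] //; rewrite /sobw/= mulr_gt0 ?invr_gt0 ?exprn_gt0//.
rewrite mulr_gt0 ?sob_const_gt0//.
have [c [C [c0 _ /(_ k.+1 isT)/andP[+ _]]]] := fine_sob_eig_bounds.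
by apply: lt_le_trans; rewrite mulr_gt0// powR_gt0.
Qed.

(* The zeroth weights agree, which forces [c <= 1 <= C]. *)
Lemma sobw_cosw : exists c C : R, [/\ 0 < c, c <= C & forall gamma, 0 < gamma ->
  forall k, c ^+ 2 * cosw alpha gamma k <= sobw gamma k /\
            sobw gamma k <= C ^+ 2 * cosw alpha gamma k].
Proof.
have [c [C [c0 C0 cC]]] := fine_sob_eig_bounds.
have K0 := sob_const_gt0.
(* Square roots, since weights compare squared norms and the constants are meant for norms. *)
pose d := Num.min 1 (Num.sqrt (sob_const * c)).
pose D := Num.max 1 (Num.sqrt (sob_const * C)).
have Kc : 0 < sob_const * c by rewrite mulr_gt0.
have KC : 0 < sob_const * C by rewrite mulr_gt0.
have d0 : 0 < d by rewrite /d lt_min ltr01 sqrtr_gt0.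
have d1 : d <= 1 by rewrite /d ge_min lexx.
have D1 : 1 <= D by rewrite /D le_max lexx.
have dc : d ^+ 2 <= sob_const * c.
  rewrite -[leRHS](sqr_sqrtr (ltW Kc)) ler_pXn2r ?nnegrE ?(ltW d0) ?sqrtr_ge0//.
  by rewrite /d ge_min lexx orbT.
have DC : sob_const * C <= D ^+ 2.
  rewrite -[leLHS](sqr_sqrtr (ltW KC)).
  rewrite ler_pXn2r ?nnegrE ?sqrtr_ge0 ?(le_trans ler01 D1)//.
  by rewrite /D le_max lexx orbT.
exists d, D; split => [//||gamma g0 k]; first exact: le_trans D1.
case: k => [|k].
  by rewrite /sobw /cosw/= !mulr1 exprn_ile1 ?(ltW d0)// exprn_ege1.
have /andP[ck Ck] := cC k.+1 isT.
have gV : 0 <= gamma ^- 2 by rewrite invr_ge0 sqr_ge0.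
rewrite /sobw /cosw/=; split.
  rewrite mulrCA ler_wpM2l//.
  apply: le_trans (ler_wpM2l (ltW K0) ck); rewrite mulrA ler_wpM2r ?powR_ge0//.
rewrite (mulrCA (D ^+ 2)) ler_wpM2l//.
by apply: le_trans (ler_wpM2l (ltW K0) Ck) _; rewrite mulrA ler_wpM2r ?powR_ge0.
Qed.

Lemma sob_inner_diag gamma (p : Pcos R) n (a : nat -> R) :
  (forall x, p x = \sum_(k < n) a k * phi k x) ->
  sob_inner alpha gamma p p = \sum_(k < n) sobw gamma k * a k ^+ 2.
Proof.
move=> pa.
have int_p : \int[mu01 R]_x p x = \sum_(k < n) a k *+ (k == 0 :> nat).
  have -> : \int[mu01 R]_x p x = \int[mu01 R]_x ((\sum_(k < n) a k * phi k x) * phi 0 x).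
    by apply: eq_Rintegral => x _; rewrite pa mulr1.
  rewrite Rintegral_lincomb.
    by apply: eq_bigr => k _; rewrite phi_orthonormal mulr_natr.
  move=> k; apply: continuous_integrable_mu01 => x.
  by apply: cvgM; exact: continuous_phi.
have form_p : sob_form alpha p p =
    sob_const * \sum_(k < n) a k ^+ 2 * fine (sob_eig s k).
  rewrite /sob_form -/sob_const; apply: (congr1 ( *%R sob_const)).
  have := Rintegral_kernel_diag n a (sob_eig_lty halpha).
  move=> <-.
  apply: eq_Rintegral => y _.
  apply: eq_Rintegral => x _.
  by rewrite !pa !expr2.
rewrite /sob_inner int_p form_p.
case: n {pa int_p form_p} => [|n]; first by rewrite !big_ord0 !mulr0 addr0.
rewrite !big_ord_recl/= sob_eig0 /= mulr0 add0r mulr1n.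
rewrite (big1 _ (fun i : 'I_n => true)) ?addr0; last by move=> i _; rewrite mulr0n.
rewrite /sobw/= mul1r expr2; congr (_ + _).
rewrite mulrA mulr_sumr; apply: eq_bigr => i _ /=; ring.
Qed.

End sobolev_norm.

Section sobolev_space.
Context {R : realType} (alpha gamma : R).
Hypotheses (halpha : 1 / 2 < alpha < 1) (gamma_gt0 : 0 < gamma).
Local Notation W := (sobw alpha gamma).
Local Notation H := (Hcos alpha gamma).

Let W_gt0 k : 0 < W k. Proof. exact: sobw_gt0. Qed.

Lemma finite_sobw (a : nat -> R) :
  (sqsum W a < +oo)%E <-> (sqsum (cosw alpha gamma) a < +oo)%E.
Proof.
have [c [C [c0 cC /(_ _ gamma_gt0) cCP]]] := sobw_cosw halpha.
have U_gt0 := @cosw_gt0 _ alpha _ gamma_gt0.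
split => afin.
  have c1 : 0 <= c^-1 by rewrite invr_ge0 ltW.
  apply: (proj1 (wnorm_le_scaled U_gt0 W_gt0 c1 _ afin)) => k.
  have [ck _] := cCP k.
  by rewrite exprVn ler_pdivlMl ?exprn_gt0.
have C0 : 0 <= C by rewrite (le_trans (ltW c0)).
by apply: (proj1 (wnorm_le_scaled W_gt0 U_gt0 C0 _ afin)) => k; have [_] := cCP k.
Qed.

(* The cosine space carrying the diagonalised Sobolev norm; the hypotheses are
   parameters so that the type can carry the normed structure. *)
Definition Hsob of 1 / 2 < alpha < 1 & 0 < gamma : Type := H.

Local Notation HS := (Hsob halpha gamma_gt0).

HB.instance Definition _ := GRing.Lmodule.on HS.

Let fin (f : H) : (sqsum W (cos_coef f) < +oo)%E.
Proof. by apply/finite_sobw; exact: finite_Hcos. Qed.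

Definition Hsob_norm (f : HS) : R := wnorm W (cos_coef (f : H)).

Let Hsob_normD (f g : HS) : Hsob_norm (f + g) <= Hsob_norm f + Hsob_norm g.
Proof.
rewrite /Hsob_norm (_ : cos_coef ((f + g : HS) : H) =
    (fun k => cos_coef (f : H) k + cos_coef (g : H) k)).
  by have [] := wnormD W_gt0 (fin f) (fin g).
apply/funext => k; have := Hcos_coefP 1 (f : H) (g : H) k.
by rewrite scale1r mul1r.
Qed.

Let Hsob_normZ (l : R) (f : HS) : Hsob_norm (l *: f) = `|l| * Hsob_norm f.
Proof.
rewrite /Hsob_norm (_ : cos_coef ((l *: f : HS) : H) =
    (fun k => l * cos_coef (f : H) k)).
  by have [] := wnormZ W_gt0 l (fin f).
apply/funext => k; have := Hcos_coefP l (f : H) (0 : H) k.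
by rewrite addr0 => ->; rewrite [X in _ + X](@cos_coef0 R k) addr0.
Qed.

Let Hsob_norm_eq0 (f : HS) : Hsob_norm f = 0 -> f = 0.
Proof.
move=> f0; apply: (@Hcos_coef_inj _ _ _ f 0) => k.
by rewrite (wnorm_eq0 W_gt0 (fin f) f0) [RHS](@cos_coef0 R k).
Qed.

HB.instance Definition _ := Lmodule_isNormed.Build R HS
  Hsob_normD Hsob_normZ Hsob_norm_eq0.

Lemma Hsob_normE (f : HS) : `|f| = wnorm W (cos_coef (f : H)).
Proof. by []. Qed.

(** Makes each coefficient Lipschitz for the Sobolev norm, so that coefficients converge along a
    Cauchy filter. *)
Lemma Hsob_coef_le (f g : HS) k :
  Num.sqrt (W k) * `|cos_coef (f : H) k - cos_coef (g : H) k| <= `|f - g|.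
Proof.
rewrite -Hcos_coefB -sqrtr_sqr -sqrtrM ?(ltW (W_gt0 k))//.
rewrite -[leRHS]ger0_norm// -sqrtr_sqr ler_sqrt ?sqr_ge0//.
exact: term_le_wnorm (fin _).
Qed.

(** The argument for weighted l2: coefficients converge one by one, bounds on finite partial sums
    pass to the limit along [F], and the limit sequence is realised by [Hcos_synthesis]. *)
Lemma Hsob_complete (F : set_system HS) : ProperFilter F -> cauchy F -> cvg F.
Proof.
move=> FF /cauchyP Fex.
have L_gt0 k : 0 < Num.sqrt (W k) by rewrite sqrtr_gt0.
have /choice[a aP] : forall k, exists ak : R, cos_coef (f : H) k @[f --> F] --> ak.
  move=> k; apply/cvg_ex; apply: cauchy_cvg; apply: cauchy_exP => e e0.
  have [f Ff] := Fex (e * Num.sqrt (W k)) (mulr_gt0 e0 (L_gt0 k)).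
  exists (cos_coef (f : H) k).
  change (F (fun g : HS => ball (cos_coef (f : H) k) e (cos_coef (g : H) k))).
  apply: filterS Ff => g.
  rewrite -!ball_normE /= => fg.
  rewrite -(ltr_pM2l (L_gt0 k)) (mulrC _ e).
  exact: le_lt_trans (Hsob_coef_le _ _ _) fg.
have close (e : R) (f : HS) : 0 < e -> F (ball f e) ->
    (sqsum W (fun k => cos_coef (f : H) k - a k)%R < +oo)%E /\
    wnorm W (fun k => cos_coef (f : H) k - a k) <= e.
  move=> e0 Ff; apply: (wnorm_le W_gt0 (ltW e0)) => n.
  have cv : \sum_(k < n) W k * (cos_coef (f : H) k - cos_coef (g : H) k) ^+ 2
      @[g --> F] --> \sum_(k < n) W k * (cos_coef (f : H) k - a k) ^+ 2.
    elim: n => [|n IH].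
      by under eq_cvg do rewrite big_ord0; rewrite big_ord0; exact: cvg_cst.
    under eq_cvg do rewrite big_ord_recr/=; rewrite big_ord_recr/=.
    apply: cvgD; first exact: IH.
    apply: cvgM; first exact: cvg_cst.
    under eq_cvg do rewrite expr2; rewrite expr2.
    by apply: cvgM; apply: cvgB; [exact: cvg_cst|exact: aP|exact: cvg_cst|exact: aP].
  rewrite -(cvg_lim _ cv)//; apply: limr_le; first exact: cvgP cv.
  apply: filterS Ff => g; rewrite -ball_normE /= Hsob_normE => fg.
  have := partial_sum_le_wnorm W_gt0 n (fin (f - g : HS)).
  rewrite (eq_bigr (fun k : 'I_n => W k * (cos_coef (f : H) k - cos_coef (g : H) k) ^+ 2)); last first.
    by move=> k _; rewrite -(Hcos_coefB (f : H) (g : H)).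
  move/le_trans; apply; rewrite ler_pXn2r ?nnegrE ?wnorm_ge0 ?(ltW e0)//.
  exact: ltW.
(* The limit sequence is the difference of the coefficients of [f] and of the sequence bounded by
   [close], both of finite norm. *)
have afin : (sqsum (cosw alpha gamma) a < +oo)%E.
  apply/finite_sobw; have [f Ff] := Fex 1 ltr01.
  have [bfin _] := close 1 f ltr01 Ff.
  have [b2fin _] := wnormZ W_gt0 (-1) bfin.
  have [+ _] := wnormD W_gt0 b2fin (fin f).
  rewrite (_ : (fun k => _) = a)//; apply/funext => k; ring.
have [g ga] := Hcos_synthesis halpha gamma_gt0 afin.
apply/cvg_ex; exists (g : HS).
apply/cvg_ballP => e e0.
have e20 : 0 < e / 2 by rewrite divr_gt0.
have [f Ff] := Fex _ e20.
have [_ fa] := close _ f e20 Ff.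
have fg : `|f - (g : HS)| <= e / 2.
  rewrite Hsob_normE; apply: le_trans fa; rewrite le_eqVlt; apply/orP; left; apply/eqP.
  by congr (wnorm _ _); apply/funext => k; rewrite Hcos_coefB ga.
apply: filterS Ff => h; rewrite -!ball_normE /= => fh.
pose g' : HS := g; change (`|g' - h| < e).
apply: le_lt_trans (ler_distD f g' h) _; rewrite [ltRHS](splitr e).
rewrite distrC in fg; exact: ler_ltD fg fh.
Qed.

HB.instance Definition _ := Uniform_isComplete.Build HS Hsob_complete.

Lemma sob_completion : exists i : {linear Pcos R -> HS},
  is_completion (sob_norm alpha gamma) i /\
  forall p, \forall x \ae mu01 R, (i p : H) x = p x.
Proof.
(* The chosen classes form a linear map because a polynomial determines its class almost
   everywhere. *)
have /choice[i0 i0P] := @Hcos_of_Pcos R alpha gamma gamma_gt0.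
have [i iE] : exists i : {linear Pcos R -> HS}, i =1 i0.
  apply: linear_exists => l p q.
  apply: (@Hcos_ae_inj _ _ _ _ _ (l *: p + q : Pcos R)) => //.
  have aeD := Lp_funD (l *: (i0 p : L2 R)) (i0 q : L2 R).
  have aeZ := Lp_funZ l (i0 p : L2 R).
  apply: filterS3 aeD aeZ (filterI (i0P p) (i0P q)) => x eD eZ [ep eq].
  change (Lp_fun (l *: (i0 p : L2 R) + (i0 q : L2 R)) x = l * p x + q x).
  by rewrite eD eZ ep eq.
have iP p : \forall x \ae mu01 R, (i p : H) x = p x by rewrite iE; exact: i0P.
exists i; split => //; split.
  move=> p; rewrite Hsob_normE /sob_norm.
  have /asboolP[n [a pa]] := Pcos_span p.
  rewrite (sob_inner_diag halpha gamma pa) /wnorm; congr Num.sqrt.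
  have cE k : cos_coef (i p : H) k = if (k < n)%N then a k else 0.
    by apply: cos_coef_lincomb; apply: filterS (iP p) => x ->; exact: pa.
  have -> : \sum_(k < n) W k * a k ^+ 2 = \sum_(k < n) W k * cos_coef (i p : H) k ^+ 2.
    by apply: eq_bigr => k _; rewrite cE ltn_ord.
  suff -> : sqsum W (cos_coef (i p : H)) =
      (\sum_(k < n) W k * cos_coef (i p : H) k ^+ 2)%:E by [].
  apply/eqP; rewrite eq_le; apply/andP; split; last first.
    by rewrite -sqr_wnorm// lee_fin; exact: partial_sum_le_wnorm.
  apply: sqsum_le => // m.
  rewrite (big_ord_widen (maxn m n) (fun k => W k * cos_coef (i p : H) k ^+ 2) (leq_maxr m n)).
  rewrite (big_ord_widen (maxn m n) (fun k => W k * cos_coef (i p : H) k ^+ 2) (leq_maxl m n)).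
  rewrite big_mkcond [leRHS]big_mkcond; apply: ler_sum => k _.
  have w0 := ltW (W_gt0 k).
  rewrite cE; case: (k < n)%N; case: (k < m)%N; rewrite ?expr0n ?mulr0//.
  by rewrite mulr_ge0 ?sqr_ge0.
move=> O [f Of] oO.
have /nbhs_ballP[e /= e0 eO] : nbhs f O by exact: open_nbhs_nbhs.
have e20 : 0 < e / 2 by rewrite divr_gt0.
have [p pP] := Hcos_approx W_gt0 (fin f) e20.
exists (i p); split; last by exists p.
apply: eO; rewrite -ball_normE/= Hsob_normE.
by apply: le_lt_trans (pP (i p) (iP p)) _; lra.
Qed.

End sobolev_space.

Theorem theorem3p1 (R : realType) (alpha : R) (halpha : 1 / 2 < alpha < 1) :
  exists c C : R, [/\ 0 < c, c <= C &
    forall gamma : R, 0 < gamma ->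
      (exists (V : completeNormedModType R) (i : {linear Pcos R -> V}),
         is_completion (sob_norm alpha gamma) i) /\
      (forall (V : completeNormedModType R) (i : {linear Pcos R -> V}),
         is_completion (sob_norm alpha gamma) i ->
         exists T : {linear Hcos alpha gamma -> V},
           [/\ extends_id i T,
               isomorphism (@Hcos_norm R alpha gamma) (fun v : V => `|v|) T,
               (forall T' : {linear Hcos alpha gamma -> V},
                  extends_id i T' ->
                  bounded_op (@Hcos_norm R alpha gamma) (fun v : V => `|v|) T' ->
                  T' =1 T) &
               (forall f : Hcos alpha gamma,
                  c * Hcos_norm f <= `|T f| <= C * Hcos_norm f)])].
Proof.
have [c [C [c0 cC cCP]]] := sobw_cosw halpha.
have C0 : 0 <= C := le_trans (ltW c0) cC.
exists c, C; split => // gamma g0.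
have [i0 [i0c i0P]] := sob_completion halpha g0.
split; first by exists (Hsob halpha g0), i0.
move=> V i ic.
have [J [K [JK KJ Jnorm Ji]]] := completion_unique i0c ic.
have W_gt0 k : 0 < sobw alpha gamma k by exact: sobw_gt0.
have U_gt0 := @cosw_gt0 _ alpha _ g0.
have finU (f : Hcos alpha gamma) := finite_Hcos g0 f.
have finW (f : Hcos alpha gamma) : (sqsum (sobw alpha gamma) (cos_coef f) < +oo)%E.
  exact/(finite_sobw halpha g0).
(* The model and the cosine space share elements and linear structure, so [T] is the isometry [J]
   read on the cosine space, and [S] below is its inverse [K]. *)
have [T TE] : exists T : {linear Hcos alpha gamma -> V},
    T =1 (J : Hsob halpha g0 -> V).
  by apply: linear_exists => a f g; exact: (linearP J).
have [S SE] : exists S : {linear V -> Hcos alpha gamma},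
    S =1 (K : V -> Hsob halpha g0).
  by apply: linear_exists => a f g; exact: (linearP K).
have Tnorm f : `|T f| = wnorm (sobw alpha gamma) (cos_coef f).
  by rewrite TE Jnorm Hsob_normE.
have Tle f : `|T f| <= C * Hcos_norm f.
  rewrite Tnorm Hcos_normE//.
  apply: (proj2 (wnorm_le_scaled W_gt0 U_gt0 C0 _ (finU f))) => k.
  by have [] := cCP _ g0 k.
have Tge f : c * Hcos_norm f <= `|T f|.
  rewrite Tnorm Hcos_normE// -ler_pdivlMl//.
  have cV : 0 <= c^-1 by rewrite invr_ge0 ltW.
  apply: (proj2 (wnorm_le_scaled U_gt0 W_gt0 cV _ (finW f))) => k.
  by rewrite exprVn ler_pdivlMl ?exprn_gt0//; have [] := cCP _ g0 k.
have Tid : extends_id i T.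
  by move=> p; exists (i0 p); [exact: i0P|rewrite TE Ji].
exists T; split => //.
- exists S; split.
  + by move=> f; rewrite SE TE; exact: JK.
  + by move=> v; rewrite TE SE; exact: KJ.
  + by exists C.
  + exists c^-1 => v; rewrite ler_pdivlMl//; apply: le_trans (Tge _) _.
    by rewrite TE SE KJ.
- move=> T' T'id [M T'M] f; apply/eqP; rewrite -subr_eq0 -normr_eq0.
  apply/eqP/le_anti; rewrite normr_ge0 andbT; apply/ler_addgt0Pr => e e0.
  (* Both operators agree on a cosine polynomial near [f], and [|M| + C] bounds their difference on
     the remainder. The absolute value covers a negative [M], and the added 1 makes the divisor
     positive. *)
  have MC : 0 < `|M| + C + 1 by rewrite ltr_wpDl// addr_ge0.
  have [p pP] := Hcos_approx U_gt0 (finU f) (divr_gt0 e0 MC).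
  have [h hp Th] := Tid p; have [h' hp' T'h] := T'id p.
  have hh : h' = h by exact: (@Hcos_ae_inj _ _ _ _ _ p).
  have -> : T' f - T f = T' (f - h) - T (f - h).
    by rewrite (linearB T') (linearB T) Th -hh T'h opprB addrA subrK.
  have := pP _ hp; rewrite -Hcos_normE//; set x := Hcos_norm _ => xe.
  have x0 : 0 <= x by exact: sqrtr_ge0.
  rewrite add0r; apply: le_trans (ler_normB _ _) _.
  apply: (@le_trans _ _ ((`|M| + C) * x)).
    rewrite mulrDl; apply: lerD (Tle _); apply: le_trans (T'M _) _.
    by rewrite ler_wpM2r// ler_norm.
  apply: (@le_trans _ _ ((`|M| + C + 1) * x)).
    by rewrite ler_wpM2r// lerDl.
  by rewrite mulrC -ler_pdivlMr.
- by move=> f; rewrite Tge Tle.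
Qed.
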